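(* Let $V$ be an $n$-dimensional complex vector space with isotropic quadric $Q\subset\mathbb{P}(V)$, let $k\geq1$ and let $\boldsymbol{\omega}=(\omega_1,\ldots,\omega_t)$ be a partition of $k$ (i.e. $\omega_1\ge\cdots\ge\omega_t\geq1$ and $\omega_1+\cdots+\omega_t=k$). The variety \[ \kappa^{nor}_{n,k,\boldsymbol{\omega}}:=\overline{\{[T]\in\mathbb{P}(V^{\otimes k})\mid T\text{ has a singular vector }k\text{-tuple }(\underbrace{[\mathbf{x}_1],\ldots,[\mathbf{x}_1]}_{\omega_1},\ldots,\underbrace{[\mathbf{x}_t],\ldots,[\mathbf{x}_t]}_{\omega_t})\text{ with }[\mathbf{x}_1],\ldots,[\mathbf{x}_t]\in\mathbb{P}(V)\setminus Q\}} \] is irreducible of codimension $(k-t)(n-1)$ in $\mathbb{P}(V^{\otimes k})$. In particular the codimension depends only on the number of parts $t$ of $\boldsymbol{\omega}$ (for fixed $n$ and $k$).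
   Context: $q$ is a quadratic form on $V$, the complexification of a positive definite real quadratic form on a real form of $V$; $q(\cdot,\cdot)$ also denotes the associated complex symmetric bilinear form, and $Q=\{q=0\}\subset\mathbb{P}(V)$. Let $q_F$ be the induced bilinear form on $V^{\otimes k}$ with $q_F(\mathbf{x}_1\otimes\cdots\otimes\mathbf{x}_k,\mathbf{y}_1\otimes\cdots\otimes\mathbf{y}_k)=\prod_iq(\mathbf{x}_i,\mathbf{y}_i)$. For $T\in V^{\otimes k}$, a tuple $([\mathbf{x}_1],\ldots,[\mathbf{x}_k])\in\mathbb{P}(V)^{\times k}$ is a singular vector $k$-tuple of $T$ if for every $i$ the vector $\mathbf{v}_i\in V$ defined by $q(\mathbf{v}_i,\mathbf{y})=q_F(T,\mathbf{x}_1\otimes\cdots\otimes\mathbf{x}_{i-1}\otimes\mathbf{y}\otimes\mathbf{x}_{i+1}\otimes\cdots\otimes\mathbf{x}_k)$ for all $\mathbf{y}\in V$ is linearly dependent with $\mathbf{x}_i$. Closures are Zariski closures. *)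

(* Defs.v *)
From HB Require Import structures.
From mathcomp Require Export all_boot all_order all_algebra.
From mathcomp Require Export mpoly.
From mathcomp Require Export boolp classical_sets reals.
From mathcomp Require Export complex.

Set Implicit Arguments.
Unset Strict Implicit.
Unset Printing Implicit Defensive.

Import Order.TTheory GRing.Theory Num.Theory.
Local Open Scope classical_set_scope.
Local Open Scope ring_scope.

Section ProjectiveSpace.
Variables (F : fieldType) (N : nat).

(* P(F^N), of dimension N - 1; its points are the lines <[x]>%VS, x != 0. *)
Definition proj := {L : {vspace 'rV[F]_N} | \dim L == 1%N}.

Definition vanishes_at (f : {mpoly F[N]}) (L : proj) : Prop :=
  forall x : 'rV[F]_N, x \in val L -> f.@[x 0] = 0.

Definition zariski_closed (Z : set proj) : Prop :=
  exists2 S : set {mpoly F[N]},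
    (forall f, S f -> exists d : nat, f \is d.-homog) &
    Z = [set L : proj | forall f, S f -> vanishes_at f L].

Definition zariski_closure (A : set proj) : set proj :=
  [set L | forall Z, zariski_closed Z -> A `<=` Z -> Z L].

Definition irreducible (A : set proj) : Prop :=
  A !=set0 /\
  forall Z1 Z2, zariski_closed Z1 -> zariski_closed Z2 ->
    A `<=` Z1 `|` Z2 -> A `<=` Z1 \/ A `<=` Z2.

(* Z = Z_0 < Z_1 < ... < Z_m; only the values Y 0, ..., Y m matter. *)
Definition irreducible_chain (Z : set proj) (m : nat) (Y : nat -> set proj) :=
  [/\ Y 0%N = Z,
      forall i, (i <= m)%N -> zariski_closed (Y i) /\ irreducible (Y i) &
      forall i, (i < m)%N -> Y i `<` Y i.+1].

(* Krull codimension in proj of an irreducible closed set: the largest length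
   of a chain of irreducible closed sets starting at Z. *)
Definition has_codim (Z : set proj) (c : nat) : Prop :=
  (exists Y, irreducible_chain Z c Y) /\
  (forall m Y, irreducible_chain Z m Y -> (m <= c)%N).

End ProjectiveSpace.

Section Tensors.
Variables (F : fieldType) (n : nat) (G : 'M[F]_n).

(* V is 'rV[F]_n; G is the Gram matrix of q in the standard basis. *)
Definition qform (x y : 'rV[F]_n) : F := (x *m G *m y^T) 0 0.

Definition isotropic_quadric : set (proj F n) :=
  [set L : proj F n | forall x : 'rV[F]_n, x \in val L -> qform x x = 0].

Variable k : nat.

(* Tensors in V^{(x) k} are given by their coordinates, indexed by k-tuples
   j of indices, in the basis e_(j_1) (x) ... (x) e_(j_k). *)
Definition tensor_dim := #|{: k.-tuple 'I_n}|.
Definition tensor := 'rV[F]_tensor_dim.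

Definition coeft (T : tensor) (j : k.-tuple 'I_n) : F := T 0 (enum_rank j).

Definition pure_tensor (x : 'I_k -> 'rV[F]_n) : tensor :=
  \row_a \prod_(i < k) x i 0 (tnth (enum_val a) i).

Definition qF (S T : tensor) : F :=
  \sum_(j : k.-tuple 'I_n) \sum_(l : k.-tuple 'I_n)
    coeft S j * coeft T l * \prod_(i < k) G (tnth j i) (tnth l i).

Lemma coeft_pure x j : coeft (pure_tensor x) j = \prod_(i < k) x i 0 (tnth j i).
Proof. by rewrite /coeft mxE enum_rankK. Qed.

Lemma qformE x y :
  qform x y = \sum_(a < n) \sum_(b < n) x 0 a * y 0 b * G a b.
Proof.
rewrite /qform mxE exchange_big; apply: eq_bigr => b _.
by rewrite !mxE big_distrl; apply: eq_bigr => a _ /=; rewrite mulrAC.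
Qed.

Lemma big_tuple_ffun (f : 'I_k -> 'I_n -> F) :
  \sum_(j : k.-tuple 'I_n) \prod_(i < k) f i (tnth j i)
  = \prod_(i < k) \sum_(a < n) f i a.
Proof.
rewrite bigA_distr_bigA /=.
rewrite (reindex (fun h : {ffun 'I_k -> 'I_n} => [tuple h i | i < k])) /=.
  by apply: eq_bigr => h _; apply: eq_bigr => i _; rewrite tnth_mktuple.
exists (fun j : k.-tuple 'I_n => [ffun i => tnth j i]) => [h _|j _].
  by apply/ffunP => i; rewrite ffunE tnth_mktuple.
by apply: eq_from_tnth => i; rewrite tnth_mktuple ffunE.
Qed.

Lemma qF_pure x y :
  qF (pure_tensor x) (pure_tensor y) = \prod_(i < k) qform (x i) (y i).
Proof.
under [RHS]eq_bigr => i _ do rewrite qformE.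
rewrite -(big_tuple_ffun (fun i a => \sum_(b < n) x i 0 a * y i 0 b * G a b)).
apply: eq_bigr => j _.
rewrite -(big_tuple_ffun
  (fun i b => x i 0 (tnth j i) * y i 0 b * G (tnth j i) b)).
by apply: eq_bigr => l _; rewrite !coeft_pure !big_split.
Qed.

(* The representatives x i are nonzero because <[x i]>%VS is a line. *)
Definition singular_tuple (T : tensor) (p : k.-tuple (proj F n)) : Prop :=
  exists2 x : 'I_k -> 'rV[F]_n,
    (forall i, val (tnth p i) = <[x i]>%VS) &
    forall i, exists2 v : 'rV[F]_n,
      (forall y, qform v y =
         qF T (pure_tensor (fun j => if j == i then y else x j))) &
      ~~ free [:: v; x i].

(* (p_1, ..., p_1, ..., p_t, ..., p_t), p_j being repeated omega_j times *)
Definition repeat_blocks (omega : seq nat) (p : seq (proj F n)) :=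
  flatten [seq nseq wp.1 wp.2 | wp <- zip omega p].

Definition has_nonisotropic_singular_tuple (omega : seq nat) (T : tensor) :=
  exists p : (size omega).-tuple (proj F n),
    (forall j, ~ isotropic_quadric (tnth p j)) /\
    exists2 s : k.-tuple (proj F n),
      tval s = repeat_blocks omega p & singular_tuple T s.

Definition kappa_nor (omega : seq nat) : set (proj F tensor_dim) :=
  zariski_closure [set L : proj F tensor_dim | exists2 T : tensor,
    val L = <[T]>%VS & has_nonisotropic_singular_tuple omega T].

End Tensors.

Arguments kappa_nor {F n} G k omega.

Definition positive_definite (R : realType) (n : nat) (G : 'M[R]_n) : Prop :=
  G^T = G /\ forall x : 'rV[R]_n, x != 0 -> 0 < qform G x x.

Definition complexify (R : realType) (n : nat) (G : 'M[R]_n) : 'M[R[i]]_n :=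
  map_mx (real_complex R) G.

Definition is_partition (k : nat) (omega : seq nat) : Prop :=
  [/\ sorted geq omega, all (leq 1) omega & sumn omega = k].

(* Main.v *)
(* A chain Z = Y_0 < Y_1 < ... < Y_m of irreducible closed sets yields forms f_i
   vanishing on Y_(i-1) but not on Y_i; adjoined to polynomials algebraically
   independent on Z, they remain independent on Y_m, and N + 1 polynomials in N
   variables are dependent. Conversely, if the cone over Z is a polynomial image
   of F^r, adding the basis vectors one at a time to Z gives at least N - r
   strict steps. Hence Z has codimension N - r as soon as r polynomials are
   algebraically independent on it.

   In a q-orthonormal basis, e_0 (x) ... (x) e_0 is singular for T_0 iff the
   coordinates of T_0 at the indices (0, ..., a, ..., 0), a <> 0, vanish. Every
   nonisotropic line is the image of <e_0> under the reflection in some u with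
   u_0 = 1, so the tensors in question are the images of such T_0 under the
   reflections in u_1, ..., u_t, repeated according to omega. This uses
   r = n^k - k (n - 1) + t (n - 1) parameters, and r coordinates of the image have
   diagonal invertible differential at u_i = e_0, T_0 = e_0 (x) ... (x) e_0;
     hence
   they are algebraically independent. *)
Require Import Defs.
From mathcomp Require Import ring.

Set Implicit Arguments.
Unset Strict Implicit.
Unset Printing Implicit Defensive.

Import Order.TTheory GRing.Theory Num.Theory.
Local Open Scope ring_scope.

(** * Algebraic independence of polynomials *)

Section Polynomials.

Lemma poly_fun0 (F : numFieldType) (p : {poly F}) :
  (forall a, p.[a] = 0) -> p = 0.
Proof.
move=> p0; apply/eqP; apply: contraT => nz_p.
have := @max_poly_roots _ p [seq i%:R | i <- iota 0 (size p)] nz_p.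
rewrite size_map size_iota ltnn; apply.
  by apply/allP => _ /mapP[i _ ->]; rewrite /root p0.
by rewrite map_inj_uniq ?iota_uniq //; exact: mulrIn (oner_neq0 F).
Qed.

(** [muni] singles out the last variable; induction on the number of variables and adjoining one
    polynomial to a family both rest on this. *)
Lemma mmap_muni n (R : comNzRingType) (S : comNzRingType) (f : {rmorphism R -> S})
    (h : 'I_n.+1 -> S) (p : {mpoly R[n.+1]}) :
  mmap f h p =
  (map_poly (mmap f (fun i => h (lift ord_max i))) (muni p)).[h ord_max].
Proof.
rewrite muniE raddf_sum /= horner_sum; apply: eq_bigr => m _.
rewrite map_polyZ /= hornerZ map_polyXn hornerXn.
rewrite mmapZ mmapX /mmap1 big_ord_recr /= mulrA; congr (_ * _ * _).
apply: eq_bigr => i _; rewrite mnmE.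
by congr (h _ ^+ m _); apply: val_inj; rewrite /= /bump leqNgt ltn_ord.
Qed.

Lemma muni_eq0 n (R : comNzRingType) (p : {mpoly R[n.+1]}) : muni p = 0 -> p = 0.
Proof.
move=> p0; rewrite -[p]comp_mpoly_id /comp_mpoly mmap_muni p0.
by rewrite rmorph0 horner0.
Qed.

Lemma mpoly_fun0 (F : numFieldType) n (p : {mpoly F[n]}) :
  (forall v, p.@[v] = 0) -> p = 0.
Proof.
elim: n => [|n IHn] in p * => p0.
  have defp : p = (p@_0)%:MP.
    apply/mpolyP => m; have -> : m = 0%MM by apply/mnmP; case.
    by rewrite mcoeffC eqxx mulr1.
  by have := p0 (fun=> 0); rewrite defp mevalC => ->; rewrite mpolyC0.
apply: muni_eq0; apply/polyP => i; rewrite coef0; apply: IHn => v.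
suff /polyP/(_ i) : map_poly (meval v) (muni p) = 0.
  by rewrite coef_map coef0.
apply: poly_fun0 => a.
pose w (i : 'I_n.+1) := if unlift ord_max i is Some j then v j else a.
have := p0 w; rewrite /meval mmap_muni /w unlift_none.
by congr (_.[_] = _); apply: eq_map_poly => q; apply: meval_eq => j;
  rewrite liftK.
Qed.

Lemma meval_mmap (F : comNzRingType) n r (g : 'I_n -> {mpoly F[r]}) v P :
  (mmap (@mpolyC r F) g P).@[v] = P.@[fun i => (g i).@[v]].
Proof.
rewrite /mmap raddf_sum /= mevalE; apply: eq_bigr => m _.
rewrite mevalM mevalC /mmap1 rmorph_prod /=; congr (_ * _).
by apply: eq_bigr => i _; rewrite rmorphXn.
Qed.

Lemma msize_prod_exp (F : idomainType) n r (g : 'I_r -> {mpoly F[n]}) e D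
    (m : 'I_r -> nat) :
  (forall i, (msize (g i)).-1 <= e)%N -> (forall i, m i <= D)%N ->
  ((msize (\prod_i g i ^+ m i)).-1 <= r * (D * e))%N.
Proof.
have deg_mul (p q : {mpoly F[n]}) :
    ((msize (p * q)).-1 <= (msize p).-1 + (msize q).-1)%N.
  have [->|nz_p] := eqVneq p 0; first by rewrite mul0r msize0.
  have [->|nz_q] := eqVneq q 0; first by rewrite mulr0 msize0.
  rewrite msizeM //.
  have : (0 < msize p)%N by rewrite lt0n msize_poly_eq0.
  have : (0 < msize q)%N by rewrite lt0n msize_poly_eq0.
  by case: (msize p) => // a; case: (msize q) => // b; rewrite addnS.
move=> ge mD; have -> : (r * (D * e) = \sum_(i < r) D * e)%N.
  by rewrite sum_nat_const card_ord.
elim/big_rec2: _ => [|i b p _ IH]; first by rewrite msize1.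
apply: leq_trans (deg_mul _ _) _; apply: leq_add => //.
apply: (@leq_trans (m i * e)); last by rewrite leq_mul2r mD orbT.
elim: (m i) => [|k IHk]; first by rewrite expr0 msize1.
by rewrite exprS mulSn (leq_trans (deg_mul _ _)) ?leq_add.
Qed.

(* Box counting: the D ^ r monomials with exponents < D in r polynomials of
   degree <= e span a space of dimension > the number of monomials in N
   variables with exponents <= r D e, as soon as N < r and D is large. *)
Lemma algindep_leq (F : fieldType) N r (g : 'I_r -> {mpoly F[N]}) :
  (forall P : {mpoly F[r]}, mmap (@mpolyC N F) g P = 0 -> P = 0) -> (r <= N)%N.
Proof.
move=> indep; rewrite leqNgt; apply/negP => ltNr.
pose e := \max_i (msize (g i)).-1.
(* Since [E] <= [D] (r e + 1) and [D] > (r e + 1)^N, one gets E^N < D^(N+1) <= D^r; all exponents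
   that occur are below [E]. *)
pose D := ((r * e).+1 ^ N).+1; pose E := (r * (D * e)).+1.
have ltED : (E ^ N < D ^ r)%N.
  have leE : (E <= D * (r * e).+1)%N by rewrite /E mulnCA mulnS ltnS leq_addl.
  apply: (@leq_trans (D ^ N.+1)); last by rewrite leq_pexp2l.
  apply: (@leq_ltn_trans ((D * (r * e).+1) ^ N)); first by case: (posnP N) =>
    [->|N_gt0]; rewrite ?expn0 ?leq_exp2r.
  by rewrite expnMn expnS mulnC ltn_pmul2r ?expn_gt0 // /D.
pose mn s b (f : {ffun 'I_s -> 'I_b}) := [multinom (f i : nat) | i < s].
pose A : 'M[F]_(#|{: {ffun 'I_r -> 'I_D}}|, #|{: {ffun 'I_N -> 'I_E}}|) :=
  \matrix_(a, b) (\prod_i g i ^+ mn _ _ (enum_val a) i)@_(mn _ _ (enum_val b)).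
have : kermx A != 0.
  rewrite -mxrank_eq0 mxrank_ker subn_eq0 -ltnNge.
  apply: leq_ltn_trans (rank_leq_col _) _.
  by rewrite !card_ffun !card_ord.
case/rowV0Pn => u /sub_kermxP uA0 /rV0Pn[a0 /negP[]]; apply/eqP.
pose P := \sum_a u 0 a *: 'X_[mn r D (enum_val a)].
have P0 : P = 0.
  apply: indep; apply/mpolyP => m; rewrite mcoeff0.
  rewrite /P (raddf_sum (mmap (@mpolyC N F) g)) (raddf_sum (mcoeff m)) /=.
  under eq_bigr => a _ do rewrite mmapZ mmapX mcoeffCM.
  have [/forallP mE|] := boolP [forall i, (m i < E)%N].
    have := congr1 (fun B : 'rV_ _ =>
      B 0 (enum_rank [ffun i => Ordinal (mE i)])) uA0.
    rewrite !mxE => uA0m; rewrite -[RHS]uA0m; apply: eq_bigr => a _;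
      rewrite !mxE enum_rankK.
    congr (_ * _@_ _); first by apply/mnmP => i; rewrite mnmE ffunE.
  rewrite negb_forall => /existsP[j]; rewrite -leqNgt => ltm; apply: big1 =>
    a _.
  suff -> : (mmap1 g (mn r D (enum_val a)))@_m = 0 by rewrite mulr0.
  apply: memN_msupp_eq0; apply/negP => /msize_mdeg_lt.
  rewrite ltnNge => /negP[].
  have ge l : ((msize (g l)).-1 <= e)%N by rewrite /e (leq_bigmax l).
  have aD l : (mn r D (enum_val a) l <= D)%N by rewrite mnmE ltnW.
  have /leq_trans-> := leqSpred (msize (mmap1 g (mn r D (enum_val a)))) => //.
  apply: (@leq_trans E); first by rewrite ltnS; exact: msize_prod_exp.
  by apply: leq_trans ltm _; rewrite mdegE (bigD1 j) //= leq_addr.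
have : P@_(mn r D (enum_val a0)) = u 0 a0.
  rewrite /P raddf_sum (bigD1 a0) //= mcoeffZ mcoeffX eqxx mulr1 big1 ?addr0 //.
  move=> a ne_a; rewrite mcoeffZ mcoeffX; case: eqP => [eq_mn|];
    last by rewrite mulr0.
  case/eqP: ne_a; apply: enum_val_inj; apply/ffunP => i; apply: val_inj.
  by have /mnmP/(_ i) := eq_mn; rewrite !mnmE.
by rewrite P0 mcoeff0.
Qed.

End Polynomials.

(** * Chains of irreducible closed sets *)

Section Cones.
Local Open Scope classical_set_scope.
Variables (F : numFieldType) (N : nat).
Implicit Types (L : proj F N) (Y Z : set (proj F N)) (P Q f : {mpoly F[N]}).
Implicit Types (X : set 'rV[F]_N).

Lemma proj_line (x : 'rV[F]_N) : x != 0 -> exists L, val L = <[x]>%VS.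
Proof.
by move=> nz_x; exists (exist _ <[x]>%VS
  (introT eqP (etrans (dim_vline x) (congr1 nat_of_bool nz_x)))).
Qed.

Lemma lineP L : exists2 x, x != 0 & val L = <[x]>%VS.
Proof.
case: L => U /= dU; exists (vpick U).
  by rewrite vpick0 -dimv_eq0 (eqP dU).
apply/esym/eqP; rewrite eqEdim -memvE memv_pick dim_vline vpick0 -dimv_eq0.
by rewrite (eqP dU).
Qed.

Definition vanishes_on X P := forall x, X x -> P.@[x 0] = 0.
Definition vanishes Y P := forall L, Y L -> vanishes_at P L.

Lemma homog_meval d f (a : F) (v : 'I_N -> F) :
  f \is d.-homog -> f.@[fun i => a * v i] = a ^+ d * f.@[v].
Proof.
move=> /dhomogP hf; rewrite !mevalE mulr_sumr; apply: eq_big_seq => m /hf dm.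
rewrite mulrCA; congr (_ * _); rewrite -dm /= mdegE -prodrXr -big_split /=.
by apply: eq_bigr => i _; rewrite exprMn.
Qed.

(** Along the line through [v] the degree-d component contributes the coefficient of X^d, so
    vanishing on a line passes to the homogeneous components. *)
Lemma meval_scale P (v : 'I_N -> F) : exists p : {poly F},
  (forall a, p.[a] = P.@[fun i => a * v i]) /\
  (forall d, p`_d = (pihomog mdeg d P).@[v]).
Proof.
exists (\poly_(d < msize P) (pihomog mdeg d P).@[v]); split=> [a|d].
  rewrite horner_poly [in RHS](pihomog_partitionE (leqnn (msize P))) raddf_sum /=.
  by apply: eq_bigr => d _; rewrite (homog_meval _ _ (pihomogP _ _ _)) mulrC.
rewrite coef_poly; case: ltnP => // led.
suff -> : pihomog mdeg d P = 0 by rewrite meval0.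
apply/mpolyP => m; rewrite mcoeff0.
rewrite pihomogE raddf_sum /= big_seq_cond big1 // => m' /andP[m'P /eqP m'd].
by have := msize_mdeg_lt m'P; rewrite m'd ltnNge led.
Qed.

Lemma vanishes_at_pihomog P L d :
  vanishes_at P L -> vanishes_at (pihomog mdeg d P) L.
Proof.
move=> P0 x Lx; have [p [p_ev p_coef]] := meval_scale P (x 0).
rewrite -p_coef (_ : p = 0) ?coef0 //; apply: poly_fun0 => a.
rewrite p_ev -[RHS](P0 (a *: x) (memvZ a Lx)).
by apply: meval_eq => i; rewrite mxE.
Qed.

Lemma vanishes_at_of_pihomog P L :
  (forall d, vanishes_at (pihomog mdeg d P) L) -> vanishes_at P L.
Proof.
move=> P0 x Lx; rewrite (pihomog_partitionE (leqnn (msize P))) raddf_sum /=.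
by apply: big1 => d _; exact: P0.
Qed.

(** Vanishing on a line through 0 means vanishing of all homogeneous components, which therefore
    serve as the defining forms. *)
Lemma zariski_closed_hypersurface P : zariski_closed [set L | vanishes_at P L].
Proof.
exists [set f | exists d, f = pihomog mdeg d P].
  by move=> _ [d ->]; exists d; exact: pihomogP.
apply/seteqP; split=> L /= P0; first by move=> _ [d ->];
  exact: vanishes_at_pihomog.
by apply: vanishes_at_of_pihomog => d; apply: P0; exists d.
Qed.

(** On the line spanned by x, [f] restricts to f(x) times a power of the parameter. Either f(x) = 0,
    or [P] restricts to the zero polynomial, because univariate polynomials form a domain. *)
Lemma vanishes_at_mul L d f P : f \is d.-homog ->
  vanishes_at (f * P) L -> vanishes_at f L \/ vanishes_at P L.
Proof.
move=> hf fP0; have [x nz_x defL] := lineP L.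
have Lx : x \in val L by rewrite defL memv_line.
have [fx0|nz_fx] := eqVneq f.@[x 0] 0.
  left=> y; rewrite defL => /vlineP[a ->].
  rewrite -[RHS](mulr0 (a ^+ d)) -fx0 -(homog_meval _ _ hf).
  by apply: meval_eq => i; rewrite mxE.
right; apply: vanishes_at_of_pihomog => e y; rewrite defL => /vlineP[a ->].
have -> : (pihomog mdeg e P).@[(a *: x) 0] = a ^+ e * (pihomog mdeg e P).@[x 0].
  by rewrite -(homog_meval _ _ (pihomogP _ _ _)); apply: meval_eq => i;
    rewrite mxE.
have [p [p_ev <-]] := meval_scale P (x 0).
suff -> : p = 0 by rewrite coef0 mulr0.
have : f.@[x 0] *: 'X^d * p = 0.
  apply: poly_fun0 => b; rewrite !hornerE p_ev [_ * b ^+ d]mulrC.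
  rewrite -(homog_meval _ _ hf) -mevalM.
  rewrite -[RHS](fP0 (b *: x) (memvZ b Lx)).
  by apply: meval_eq => i; rewrite mxE.
move/eqP; rewrite mulf_eq0 scaler_eq0 (negbTE nz_fx) -size_poly_eq0 size_polyXn /=.
by move/eqP.
Qed.

Lemma irreducible_mul Y d f P : irreducible Y -> f \is d.-homog ->
  vanishes Y (f * P) -> ~ vanishes Y f -> vanishes Y P.
Proof.
move=> [_ irrY] hf fP0 nf0.
have [||] // := irrY _ _ (zariski_closed_hypersurface f)
                      (zariski_closed_hypersurface P).
by move=> L /fP0/(vanishes_at_mul hf).
Qed.

Definition algindep_on Y r (g : 'I_r -> {mpoly F[N]}) :=
  forall P : {mpoly F[r]}, vanishes Y (mmap (@mpolyC N F) g P) -> P = 0.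

(** A relation is a polynomial in [f] with coefficients in the [g i]. On [Y] only its constant term
    survives, which is therefore zero; irreducibility of [Y'] then allows division by [f], and the
    degree drops. *)
Lemma algindep_onS Y Y' r (g : 'I_r -> {mpoly F[N]}) d f :
    irreducible Y' -> f \is d.-homog -> vanishes Y f -> ~ vanishes Y' f ->
    Y `<=` Y' -> algindep_on Y g ->
  algindep_on Y' (fun i : 'I_r.+1 =>
                    if unlift ord_max i is Some j then g j else f).
Proof.
move=> irrY' hf f0 nf0 sYY' indep P; rewrite mmap_muni unlift_none => P0.
apply: muni_eq0; move: (muni P) P0 => q.
have -> : (map_poly (mmap (@mpolyC N F) (fun i => if unlift ord_max
   (lift ord_max i) is Some j then g j else f)) q) =
   map_poly (mmap (@mpolyC N F) g) q.
  by apply: eq_map_poly => c; congr mmap; apply/funext => j; rewrite liftK.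
elim/poly_ind: q => // q c IH;
  rewrite rmorphD rmorphM /= map_polyX map_polyC /=.
rewrite hornerD hornerC hornerMX => qc0.
have c0 : c = 0.
  apply: indep => L YL x Lx; have := qc0 L (sYY' _ YL) x Lx.
  by rewrite mevalD mevalM (f0 L YL x Lx) mulr0 add0r.
move: qc0; rewrite c0 rmorph0 addr0 mulrC => qc0.
by rewrite (IH (irreducible_mul irrY' hf qc0 nf0)) mul0r addr0.
Qed.

Lemma irreducible_chain_leq Z m (Y : nat -> set (proj F N)) r
    (g : 'I_r -> {mpoly F[N]}) :
  irreducible_chain Z m Y -> algindep_on Z g -> (r + m <= N)%N.
Proof.
case=> Y0 irrY sY indep.
have [h indh] : exists h : 'I_(r + m) -> {mpoly F[N]}, algindep_on (Y m) h.
  elim: m => [|m IH] in irrY sY *.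
    by rewrite addn0; exists g; rewrite Y0.
  have [||h indh] := IH; first by move=> i im; exact/irrY/leqW.
    by move=> i im; exact/sY/leqW.
  have [clY _] := irrY m (leqnSn m).
  have [_ irrY'] := irrY m.+1 (leqnn _).
  have [S homS defY] := clY.
  have [sub nsub] := sY m (leqnn _).
  have [f [Sf nf0]] : exists f, S f /\ ~ vanishes (Y m.+1) f.
    apply: contrapT => noS; apply: nsub => L YL; rewrite defY => f Sf.
    by apply: contrapT => nfL; apply: noS; exists f; split=> // f0;
      exact/nfL/f0.
  have [d hf] := homS f Sf.
  rewrite addnS; exists (fun i : 'I_(r + m).+1 =>
                    if unlift ord_max i is Some j then h j else f).
  by apply: algindep_onS hf _ nf0 sub indh => // L; rewrite defY => /(_ f Sf).
apply: (algindep_leq (g := h)) => P P0; apply: indh; rewrite P0 => L _ x _.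
exact: meval0.
Qed.

End Cones.

(** * Closures of polynomial images of affine space *)

Section PolynomialImages.
Local Open Scope classical_set_scope.
Variables (F : numFieldType) (N : nat).
Implicit Types (L : proj F N) (Y Z : set (proj F N)) (P Q f : {mpoly F[N]}).
Implicit Types (X : set 'rV[F]_N).

Definition proj_closure X : set (proj F N) :=
  [set L | forall d f, f \is d.-homog -> vanishes_on X f -> vanishes_at f L].

(** The nonzero vector makes the projective closure nonempty, as irreducibility demands. *)
Definition is_cone X :=
  (forall a x, X x -> X (a *: x)) /\ exists2 x, X x & x != 0.

Definition mpoly_map r (psi : 'I_N -> {mpoly F[r]}) (y : 'I_r -> F) : 'rV[F]_N :=
  \row_j (psi j).@[y].

Definition polynomial_image X r (psi : 'I_N -> {mpoly F[r]}) :=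
  X = range (mpoly_map psi).

Lemma zariski_closed_proj_closure X : zariski_closed (proj_closure X).
Proof.
exists [set f | exists2 d, f \is d.-homog & vanishes_on X f].
  by move=> f [d hf _]; exists d.
apply/seteqP; split=> L /= XL; first by move=> f [d hf f0]; exact: XL hf f0.
by move=> d f hf f0; apply: XL; exists d.
Qed.

Lemma vanishes_on_pihomog X P d : is_cone X ->
  vanishes_on X P -> vanishes_on X (pihomog mdeg d P).
Proof.
move=> [coneX _] P0 x Xx; have [p [p_ev <-]] := meval_scale P (x 0).
rewrite (_ : p = 0) ?coef0 //; apply: poly_fun0 => a.
rewrite p_ev -[RHS](P0 (a *: x) (coneX _ _ Xx)).
by apply: meval_eq => i; rewrite mxE.
Qed.

Lemma proj_closure_line X x L :
  X x -> val L = <[x]>%VS -> proj_closure X L.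
Proof.
move=> Xx defL d f hf f0 y; rewrite defL => /vlineP[a ->].
rewrite -[RHS](mulr0 (a ^+ d)) -(f0 x Xx) -(homog_meval _ _ hf).
by apply: meval_eq => i; rewrite mxE.
Qed.

Lemma vanishes_proj_closure X P : is_cone X ->
  vanishes (proj_closure X) P <-> vanishes_on X P.
Proof.
move=> coneX; split=> P0 => [x Xx|L XL].
  have [->|nz_x] := eqVneq x 0.
    have [x' Xx' /proj_line[L defL]] := coneX.2.
    by apply: (P0 L) (mem0v _); exact: proj_closure_line Xx' defL.
  have [L defL] := proj_line nz_x.
  by apply: (P0 L); rewrite ?defL ?memv_line //;
    exact: proj_closure_line Xx defL.
apply: vanishes_at_of_pihomog => d; apply: XL (pihomogP _ _ _) _.
exact: vanishes_on_pihomog.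
Qed.

(** A polynomial over an infinite field is determined by its values, so vanishing on the image
    becomes an identity in a polynomial ring. *)
Lemma vanishes_on_image X r (psi : 'I_N -> {mpoly F[r]}) P :
  polynomial_image X psi -> vanishes_on X P <-> mmap (@mpolyC r F) psi P = 0.
Proof.
have ev y : (mmap (@mpolyC r F) psi P).@[y] = P.@[mpoly_map psi y 0].
  by rewrite meval_mmap; apply: meval_eq => i; rewrite mxE.
move=> ->; split=> [P0|P0 _ [y _ <-]]; last by rewrite -ev P0 meval0.
by apply: mpoly_fun0 => y; rewrite ev; apply: P0; exists y.
Qed.

(** The ideal of the image is the kernel of the pullback to a domain: two forms with nonzero
    pullbacks have a product that does not vanish on [X]. *)
Lemma irreducible_proj_closure X r (psi : 'I_N -> {mpoly F[r]}) :
  is_cone X -> polynomial_image X psi -> irreducible (proj_closure X).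
Proof.
move=> coneX imX; split.
  have [x Xx /proj_line[L defL]] := coneX.2.
  by exists L; exact: proj_closure_line Xx defL.
move=> Z1 Z2 [S1 hS1 ->] [S2 hS2 ->] sXZ; apply: contrapT => /not_orP[n1 n2].
have wit (S : set {mpoly F[N]}) :
    ~ proj_closure X `<=` [set L | forall f, S f -> vanishes_at f L] ->
    exists f, S f /\ mmap (@mpolyC r F) psi f != 0.
  move=> nS; apply: contrapT => nf; apply: nS => L XL f Sf.
  have : vanishes (proj_closure X) f; last exact.
  apply/vanishes_proj_closure/(vanishes_on_image _ imX) => //.
  by apply/eqP; apply: contrapT => /negP nz; apply: nf; exists f.
have [f1 [S1f1 nz1]] := wit _ n1; have [f2 [S2f2 nz2]] := wit _ n2.
have : mmap (@mpolyC r F) psi (f1 * f2) != 0 by rewrite rmorphM mulf_neq0.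
case/eqP; apply/(vanishes_on_image _ imX)/vanishes_proj_closure => // L /sXZ.
move=> -[/(_ _ S1f1) f0|/(_ _ S2f2) f0] x Lx; rewrite mevalM f0 //.
  by rewrite mul0r.
by rewrite mulr0.
Qed.

(** This is X + <e_0, ..., e_(s-1)>; for nonempty [X] it grows from [X] at s = 0 to the whole space
    at s = N. *)
Definition thicken X s : set 'rV[F]_N :=
  [set x | exists2 y, X y & forall j : 'I_N, (s <= j)%N -> x 0 j = y 0 j].

Lemma is_cone_thicken X s : is_cone X -> is_cone (thicken X s).
Proof.
move=> [coneX [x Xx nz_x]]; split; last by exists x => //; exists x.
move=> a z [y Xy eq_y]; exists (a *: y); first exact: coneX.
by move=> j sj; rewrite !mxE eq_y.
Qed.

Lemma polynomial_image_thicken X s r (psi : 'I_N -> {mpoly F[r]}) :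
  polynomial_image X psi ->
  polynomial_image (thicken X s) (fun j : 'I_N =>
    if (s <= j)%N then mmap (@mpolyC (r + N) F) (fun i =>
      'X_(lshift N i)) (psi j)
    else 'X_(rshift r j)).
Proof.
have ev (p : {mpoly F[r]}) (v : 'I_(r + N) -> F) :
    (mmap (@mpolyC (r + N) F) (fun i => 'X_(lshift N i)) p).@[v] =
    p.@[fun i => v (lshift N i)].
  by rewrite meval_mmap; apply: meval_eq => i; rewrite mevalXU.
move=> ->; apply/seteqP; split=> [x [_ [y _ <-] eq_x]|_ [y _ <-]] /=.
  exists (fun i => match split i with inl i' => y i' | inr j => x 0 j end) =>
    //.
  apply/rowP => j; rewrite mxE; case: ifP => [sj|_].
    rewrite eq_x // mxE ev; apply: meval_eq => i.
    by rewrite (unsplitK (inl i : 'I_r + 'I_N)).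
  by rewrite mevalXU (unsplitK (inr j : 'I_r + 'I_N)).
exists (mpoly_map psi (fun i => y (lshift N i))).
  by exists (fun i => y (lshift N i)).
by move=> j sj; rewrite !mxE sj ev.
Qed.

Lemma thicken0 X : thicken X 0 = X.
Proof.
apply/seteqP; split=> x; last by exists x.
by case=> y Xy eq_x; rewrite (_ : x = y) //; apply/rowP => j; exact: eq_x.
Qed.

Lemma subset_thicken X s : thicken X s `<=` thicken X s.+1.
Proof. by move=> x [y Xy eq_x]; exists y => // j sj; exact/eq_x/ltnW. Qed.

Lemma subset_proj_closure X X' :
  X `<=` X' -> proj_closure X `<=` proj_closure X'.
Proof. by move=> sX L XL d f hf f0; apply: XL hf _ => x /sX; exact: f0. Qed.

(* The coordinates [j] for which the [j]-th thickening is not strict are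
   algebraically independent on [X]: a relation between them on [X] propagates to
   all thickenings of [X], the last of which is the whole space. *)
Lemma irreducible_chain_proj_closure X r (psi : 'I_N -> {mpoly F[r]}) :
  is_cone X -> polynomial_image X psi ->
  exists m (Y : nat -> set (proj F N)),
    irreducible_chain (proj_closure X) m Y /\ (N <= m + r)%N.
Proof.
move=> coneX imX; pose Z s := proj_closure (thicken X s).
pose J := [pred j : 'I_N | `[< Z j = Z j.+1 >]].
have leJr : (#|J| <= r)%N.
  apply: (algindep_leq (g := fun i : 'I_#|J| => psi (enum_val i))) => P P0.
  have evJ (x : 'rV[F]_N) :
      (mmap (@mpolyC N F) (fun i : 'I_#|J| => 'X_(enum_val i)) P).@[x 0] =
      P.@[fun i => x 0 (enum_val i)].
    by rewrite meval_mmap; apply: meval_eq => i; rewrite mevalXU.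
  set Q := mmap _ _ _ in evJ.
  suff Q0 s : (s <= N)%N -> vanishes_on (thicken X s) Q.
    apply: mpoly_fun0 => v.
    pose x : 'rV[F]_N := \row_j \sum_(i | enum_val i == j) v i.
    have X0 : exists y, X y by have [_ [y Xy _]] := coneX; exists y.
    have [y Xy] := X0; have := Q0 N (leqnn _) x; rewrite evJ => <-.
      apply: meval_eq => i; rewrite mxE (eq_bigl (pred1 i)) ?big_pred1_eq //.
      by move=> i'; rewrite /= (inj_eq enum_val_inj).
    by exists y => // j; rewrite leqNgt ltn_ord.
  elim: s => [_|s IHs sN] .
    rewrite thicken0 imX => _ [y _ <-]; rewrite evJ.
    have := congr1 (meval y) P0; rewrite meval_mmap meval0 => <-.
    by apply: meval_eq => i; rewrite mxE.
  have Qs := IHs (ltnW sN); have [Zs|nZs] := pselect (Z s = Z s.+1).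
    apply/vanishes_proj_closure; first exact: is_cone_thicken.
    by rewrite -/(Z _) -Zs; apply/vanishes_proj_closure => //;
      exact: is_cone_thicken.
  move=> x [y Xy eq_x]; rewrite evJ.
  (* Here [s] lies outside [J], so [Q] does not involve coordinate [s]; replacing it by that of [y]
     moves [x] into the previous thickening and keeps the value of [Q]. *)
  pose x' := \row_j if j == s :> nat then y 0 j else x 0 j.
  rewrite -[RHS](Qs x') ?evJ.
    apply: meval_eq => i; rewrite mxE; case: eqP => // is_.
    by have /asboolP := enum_valP i; rewrite is_.
  exists y => // j; rewrite mxE leq_eqVlt [s == _]eq_sym.
  by case: eqP => //= _; exact: eq_x.
pose cnt s := (\sum_(i < N | i < s) ~~ J i)%N.
have chain s : (s <= N)%N ->
    exists Y : nat -> set (proj F N),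
      irreducible_chain (Z 0%N) (cnt s) Y /\ Y (cnt s) = Z s.
  have irrZ s' : zariski_closed (Z s') /\ irreducible (Z s').
    split; first exact: zariski_closed_proj_closure.
    exact: irreducible_proj_closure (is_cone_thicken _ coneX)
      (polynomial_image_thicken _ imX).
  elim: s => [_|s IHs sN].
    have -> : cnt 0%N = 0%N by rewrite /cnt big1.
    by exists (fun=> Z 0%N); split.
  have cntS : cnt s.+1 = (~~ J (Ordinal sN) + cnt s)%N.
    rewrite /cnt (bigD1 (Ordinal sN)) //=; congr (_ + _)%N.
    apply: eq_bigl => i; rewrite -val_eqE /= ltnS [RHS]ltn_neqAle.
    by rewrite andbC.
  have [Y [[Y0 irrY sY] Ys]] := IHs (ltnW sN); rewrite cntS /=.
  case: asboolP => [Zs|nZs]; first by exists Y; rewrite Ys.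
  exists (fun i => if (i <= cnt s)%N then Y i else Z s.+1).
  rewrite /= add1n ltnn; split=> //; split=> [//|i|i] /=.
    by case: (leqP i (cnt s)) => [ic _|_ _]; [exact: irrY|exact: irrZ].
  rewrite ltnS => le_i; rewrite le_i; case: (ltnP i (cnt s)) => [ic|ge_i];
    first exact: sY.
  rewrite (_ : i = cnt s) ?Ys; last by apply/eqP; rewrite eqn_leq le_i.
  split; first exact/subset_proj_closure/subset_thicken.
  by move=> sZ; apply: nZs; apply/seteqP; split => //;
    exact/subset_proj_closure/subset_thicken.
have [Y []] := chain N (leqnn N); rewrite /Z thicken0 => chY _.
exists (cnt N), Y; split=> //.
rewrite -[X in (X <= _)%N]card_ord -(cardC J) addnC leq_add //.
rewrite /cnt -sum1_card big_mkcond [X in (_ <= X)%N]big_mkcond /=.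
by apply: leq_sum => i _; rewrite ltn_ord !inE /=; case: asboolP.
Qed.

(** The chain of thickenings has at least N - r steps and is cut after that many; the r independent
    polynomials bound the length of every chain. *)
Lemma has_codim_proj_closure X r (psi : 'I_N -> {mpoly F[r]})
    (g : 'I_r -> {mpoly F[N]}) :
  is_cone X -> polynomial_image X psi -> algindep_on (proj_closure X) g ->
  has_codim (proj_closure X) (N - r).
Proof.
move=> coneX imX indep; split.
  have [m [Y [[Y0 irrY sY] leN]]] := irreducible_chain_proj_closure coneX imX.
  have lem : (N - r <= m)%N by rewrite leq_subLR addnC.
  exists Y; split=> [//|i im|i im].
    exact: irrY (leq_trans im lem).
  exact: sY (leq_trans im lem).
move=> m Y /irreducible_chain_leq/(_ indep) le_rm.
by rewrite leq_subRL // (leq_trans _ le_rm) ?leq_addr.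
Qed.

End PolynomialImages.

(** * Vanishing of a polynomial from first-order data along curves *)

Section FirstOrder.
Variable F : numFieldType.

Lemma mmap_mmap n r (S : comNzRingType) (f : {rmorphism F -> S}) (h : 'I_r -> S)
    (g : 'I_n -> {mpoly F[r]}) P :
  mmap f h (mmap (@mpolyC r F) g P) = mmap f (fun i => mmap f h (g i)) P.
Proof.
rewrite {2}/mmap (raddf_sum (mmap f h)) /=; apply: eq_bigr => m _.
rewrite rmorphM /= mmapC /mmap1 rmorph_prod /=; congr (_ * _).
by apply: eq_bigr => i _; rewrite rmorphXn.
Qed.

(** On a curve through 0 with velocity [z], the coefficient of X^d is the degree-d component of [P]
    at [z] once the lower components are known to vanish. As [z] is arbitrary, that component is
    zero. *)
Lemma mpoly_eq0_order1 r (P : {mpoly F[r]}) :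
  (forall z : 'I_r -> F, exists H : 'I_r -> {poly F},
     (forall i, (H i)`_0 = z i) /\
     mmap (@polyC F) (fun i => H i * 'X) P = 0) ->
  P = 0.
Proof.
move=> P0; suff Pd d : forall m, mdeg m = d -> P@_m = 0.
  by apply/mpolyP => m; rewrite mcoeff0 (Pd _ m erefl).
elim/ltn_ind: d => d IH m dm; pose Q := pihomog mdeg d P.
have Q0 : Q = 0.
  apply: mpoly_fun0 => z; have [H [Hz /(congr1 (fun q : {poly F} =>
    q`_d))]] := P0 z.
  rewrite coef0 => <-; rewrite /Q pihomogE raddf_sum /= /mmap coef_sum.
  rewrite big_mkcond /=; apply: eq_big_seq => m' m'P; rewrite coefCM /mmap1.
  under [in RHS]eq_bigr => i _ do rewrite exprMn.
  rewrite big_split /= prodrXr -mdegE coefMXn.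
  case: ltngtP => [lt_m'|lt_m'|->]; last 1 first.
  - rewrite subnn mevalZ mevalX; congr (_ * _).
    rewrite -horner_coef0 horner_prod; apply: eq_bigr => i _.
    by rewrite horner_exp horner_coef0 Hz.
  - by rewrite mulr0.
  - by rewrite (IH _ lt_m') // mul0r.
have [mP|/memN_msupp_eq0 //] := boolP (m \in msupp P).
have : Q@_m = P@_m.
  rewrite /Q pihomogE raddf_sum /= big_mkcond /= (bigD1_seq m) //= dm eqxx.
  rewrite mcoeffZ mcoeffX eqxx mulr1 big1 ?addr0 // => m' /negPf ne_m'.
  by case: ifP => // _; rewrite mcoeffZ mcoeffX ne_m' mulr0.
by rewrite Q0 mcoeff0.
Qed.

(* Comparing terms of lowest degree after moving [beta] to the origin. *)
Lemma mpoly_eq0_first_order r (P : {mpoly F[r]}) (beta lam : 'I_r -> F) :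
  (forall i, lam i != 0) ->
  (forall z : 'I_r -> F, exists G : 'I_r -> {poly F},
     [/\ forall i, (G i)`_0 = beta i, forall i, (G i)`_1 = lam i * z i &
         mmap (@polyC F) G P = 0]) ->
  P = 0.
Proof.
move=> nz_lam P0.
pose shift i : {mpoly F[r]} := (beta i)%:MP + (lam i)%:MP * 'X_i.
pose unshift i : {mpoly F[r]} := (lam i)^-1%:MP * ('X_i - (beta i)%:MP).
pose P' := mmap (@mpolyC r F) shift P.
have defP : P = mmap (@mpolyC r F) unshift P'.
  rewrite mmap_mmap -[LHS]comp_mpoly_id /comp_mpoly; congr mmap; apply/funext =>
    i.
  rewrite tnth_mktuple /shift mmapD mmapC rmorphM /= mmapC mmapX mmap1U.
  by rewrite mulrA -mpolyCM divff // mpolyC1 mul1r addrC subrK.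
rewrite defP (_ : P' = 0) ?rmorph0 //; apply: mpoly_eq0_order1 => z.
have [G [G0 G1 <-]] := P0 z.
(* [drop_poly 1 (G i)] is (G i - beta i) / X, with constant term [lam i * z i]. *)
exists (fun i => (lam i)^-1 *: drop_poly 1 (G i)); split=> [i|].
  by rewrite coefZ coef_drop_poly add0n G1 mulKf.
rewrite mmap_mmap; congr mmap; apply/funext => i.
rewrite /shift mmapD mmapC rmorphM /= mmapC mmapX mmap1U.
rewrite -scalerAl mul_polyC scalerA divff // scale1r -{2}(poly_take_drop 1 (G i)).
congr (_ + _); apply/polyP => j; rewrite coefC coef_take_poly.
by case: j => [|j] //; rewrite G0.
Qed.

End FirstOrder.

(** * Reflections *)

(** Symmetric elimination: clearing the first row and column leaves the Schur complement [H'], again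
    positive definite, and the positive pivot [a] has a square root. The rows of [B] form an
    orthonormal basis. *)
Lemma positive_definite_orthonormal (R : realType) n (G : 'M[R]_n) :
  positive_definite G -> exists B : 'M[R]_n, B *m G *m B^T = 1%:M.
Proof.
elim: n => [|n IHn] in G * => [_|[symG posG]].
  by exists 1%:M; apply/matrixP => -[].
rewrite -[n.+1]/(1 + n)%N in G symG posG *.
pose a := G 0 0; pose v := ursubmx G; pose H := drsubmx G.
have defG : G = block_mx a%:M v v^T H.
  rewrite -[LHS]submxK; congr block_mx.
    apply/matrixP => i j; rewrite !ord1 !mxE eqxx mulr1n.
    by congr (G _ _); apply: val_inj.
  by rewrite /v trmx_ursub symG.
have a_gt0 : 0 < a.
  have := posG (row_mx 1%:M 0);
    rewrite /qform defG mul_row_block tr_row_mx mul_row_col.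
  rewrite !mul0mx !addr0 trmx0 mulmx0 addr0 trmx1 mulmx1 mul1mx mxE eqxx mulr1n.
  apply; apply/eqP => /(congr1 lsubmx)/matrixP/(_ 0 0);
    rewrite row_mxKl !mxE eqxx.
  by move/eqP; rewrite mulr1n oner_eq0.
pose w : 'rV[R]_n := - a^-1 *: v.
pose E : 'M[R]_(1 + n) := block_mx 1%:M 0 w^T 1%:M.
pose H' := H - a^-1 *: (v^T *m v).
have EGE : E *m G *m E^T = block_mx a%:M 0 0 H'.
  rewrite defG /E tr_block_mx !mulmx_block !trmx1 trmx0 trmxK.
  rewrite !mul0mx !mul1mx !mulmx1 !mulmx0 !addr0 !mul_scalar_mx !mul_mx_scalar.
  have -> : a *: w + v = 0 by rewrite /w scalerA mulrN divff ?gt_eqF // scaleN1r addNr.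
  have -> : a *: w^T + v^T = 0.
    by rewrite /w linearZ /= scalerA mulrN divff ?gt_eqF // scaleN1r addNr.
  by rewrite mul0mx add0r /w linearZ /= -scalemxAl scaleNr addrC.
have H'pos : positive_definite H'.
  split=> [|x nz_x].
    have symH : H^T = H by rewrite /H trmx_drsub symG.
    by rewrite /H' linearB linearZ /= trmx_mul trmxK symH.
  have -> : qform H' x x = qform G (row_mx 0 x *m E) (row_mx 0 x *m E).
    rewrite /qform [(_ *m E)^T]trmx_mul !mulmxA -(mulmxA _ E) -(mulmxA _ (E *m G)) EGE.
    rewrite tr_row_mx mul_row_block mul_row_col !mul0mx !mulmx0 !add0r.
    by rewrite trmx0 mulmx0 add0r.
  apply: posG; apply/eqP; rewrite /E mul_row_block mul0mx add0r mulmx1 mulmx0 add0r.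
  move/(congr1 rsubmx); rewrite row_mxKr => x0; case/eqP: nz_x.
  by rewrite x0; apply/matrixP => i j; rewrite !mxE.
have [B' HB'] := IHn _ H'pos.
exists (block_mx (Num.sqrt a)^-1%:M 0 0 B' *m E).
rewrite trmx_mul !mulmxA -(mulmxA _ E) -(mulmxA _ (E *m G)) EGE.
rewrite tr_block_mx !mulmx_block !trmx0 !mul0mx !mulmx0 !add0r !addr0.
rewrite ?mul0mx ?mulmx0 ?addr0 HB' tr_scalar_mx -!scalar_mxM.
rewrite -{2}(sqr_sqrtr (ltW a_gt0)) expr2 mulKf ?divff ?gt_eqF ?sqrtr_gt0 //.
by rewrite -scalar_mx_block.
Qed.

Section Reflection.

Definition sqnorm (K : comNzRingType) n (u : 'rV[K]_n) : K := (u *m u^T) 0 0.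

(* [sqnorm u] times the reflection in the hyperplane orthogonal to [u], so that
   it is polynomial in [u]. *)
Definition refl (K : comNzRingType) n (u : 'rV[K]_n) : 'M[K]_n :=
  (sqnorm u)%:M - 2%:R *: (u^T *m u).

Lemma refl_trmx (K : comNzRingType) n (u : 'rV[K]_n) : (refl u)^T = refl u.
Proof. by rewrite /refl linearB linearZ /= tr_scalar_mx trmx_mul trmxK. Qed.

(** [u^T *m u] squares to [sqnorm u] times itself, so the terms in it cancel. Thus [refl u] is a
    similitude. *)
Lemma refl_sqr (K : comNzRingType) n (u : 'rV[K]_n) :
  refl u *m (refl u)^T = (sqnorm u ^+ 2)%:M.
Proof.
rewrite refl_trmx /refl; set c := sqnorm u; set A := u^T *m u.
have AA : A *m A = c *: A.
  rewrite /A mulmxA -(mulmxA _ u) [u *m u^T]mx11_scalar -/(sqnorm u) -/c.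
  by rewrite mul_mx_scalar -scalemxAl.
rewrite mulmxBl !mulmxBr -!scalemxAl -!scalemxAr AA.
rewrite !mul_scalar_mx mul_mx_scalar scale_scalar_mx -expr2 !scalerA.
rewrite (_ : (2 * (2 * c)) *: A = (2 * c) *: A + (2 * c) *: A).
  by rewrite opprB addrK subrK.
by rewrite -scalerDl mulr_natl mulr2n.
Qed.

Lemma map_refl (K K' : comNzRingType) (f : {rmorphism K -> K'}) n (u : 'rV[K]_n) :
  map_mx f (refl u) = refl (map_mx f u).
Proof.
have map_sq : f (sqnorm u) = sqnorm (map_mx f u).
  by rewrite /sqnorm map_trmx -map_mxM [RHS]mxE.
by rewrite /refl map_mxB map_scalar_mx map_mxZ map_mxM -map_trmx rmorph_nat map_sq.
Qed.

(** After scaling [x] to a unit vector w, the reflection in e_0 - w exchanges e_0 and w; division by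
    1 - w_0 gives [u] the first coordinate 1. *)
Lemma nonisotropic_refl (F : numClosedFieldType) n (x : 'rV[F]_n.+1) :
  sqnorm x != 0 -> exists u : 'rV[F]_n.+1,
  [/\ u 0 0 = 1, sqnorm u != 0 &
      exists2 c, c != 0 & x = c *: (delta_mx 0 0 *m refl u)].
Proof.
move=> nz_x.
pose e : 'rV[F]_n.+1 := delta_mx 0 0.
have sqE (v : 'rV[F]_n.+1) : sqnorm v = \sum_i v 0 i ^+ 2.
  by rewrite /sqnorm mxE; apply: eq_bigr => i _; rewrite mxE expr2.
have [w [w1 nw0 [c nz_c defx]]] : exists w : 'rV[F]_n.+1,
    [/\ sqnorm w = 1, w 0 0 != 1 & exists2 c, c != 0 & x = c *: w].
  pose m := sqrtC (sqnorm x); have nz_m : m != 0 by rewrite sqrtC_eq0.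
  have nm b : sqnorm ((((-1) ^+ b * m)^-1) *: x) = 1.
    rewrite sqE; under eq_bigr => i _ do rewrite mxE exprMn.
    by rewrite -mulr_sumr -sqE exprVn exprMn sqrr_sign mul1r sqrtCK mulVf.
  have nz_b (b : bool) : (-1) ^+ b * m != 0 by rewrite mulf_neq0 ?signr_eq0.
  (* The sign of the square root is switched when x_0 = m; this keeps the first coordinate of the
     unit vector away from 1. *)
  pose b := (x 0 0 == m).
  exists (((-1) ^+ b * m)^-1 *: x); split=> //; last first.
    by exists ((-1) ^+ b * m); rewrite ?scalerA ?divff ?scale1r.
  rewrite mxE mulrC; apply/eqP => /(canRL (mulfVK (nz_b b))); rewrite mul1r /b.
  case: eqP => [->|]; last by rewrite mul1r.
  by rewrite mulN1r => /eqP; rewrite -addr_eq0 -mulr2n mulrn_eq0 (negbTE nz_m).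
have nz_w : 1 - w 0 0 != 0 by rewrite subr_eq0 eq_sym.
pose u := (1 - w 0 0)^-1 *: (e - w).
have u1 : u 0 0 = 1 by rewrite !mxE eqxx mulVf.
have nu : sqnorm u = 2%:R / (1 - w 0 0).
  have w1' : \sum_(i < n) w 0 (lift 0 i) ^+ 2 = 1 - w 0 0 ^+ 2.
    by rewrite -w1 sqE big_ord_recl addrAC subrr add0r.
  rewrite sqE big_ord_recl u1 (eq_bigr (fun i =>
    (1 - w 0 0) ^- 2 * w 0 (lift 0 i) ^+ 2)) => [|i _]; last first.
    by rewrite !mxE eqxx sub0r mulrN sqrrN exprMn exprVn.
  by rewrite -mulr_sumr w1'; field.
exists u; split=> //; first by rewrite nu mulf_neq0 ?pnatr_eq0 ?invr_eq0.
exists (c * ((1 - w 0 0) / 2%:R)).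
  by rewrite !mulf_neq0 ?invr_eq0 ?pnatr_eq0.
rewrite defx -scalerA; congr (_ *: _).
rewrite /refl mulmxBr mul_mx_scalar -scalemxAr mulmxA.
have -> : e *m u^T = 1%:M.
  by rewrite [LHS]mx11_scalar -rowE mxE mxE u1.
rewrite mul1mx -/e nu /u scalerA scalerBr !scalerA.
have -> : (1 - w 0 0) / 2 * (2 / (1 - w 0 0)) = 1 by field.
by rewrite !scale1r subKr.
Qed.

End Reflection.

(** * Singular tuples *)

Section TensorAction.
Variables (n k : nat).
Implicit Types (j l : k.-tuple 'I_n).

(* Coordinates of the image of the tensor with coordinates [S] under
   [M 0 (x) ... (x) M (k - 1)], acting on the right on row vectors. *)
Definition tact (K : comNzRingType) (S : k.-tuple 'I_n -> K)
    (M : 'I_k -> 'M[K]_n) j : K :=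
  \sum_l S l * \prod_(i < k) M i (tnth l i) (tnth j i).

Lemma tact_comp (F : fieldType) S (M M' : 'I_k -> 'M[F]_n) j :
  tact (tact S M) M' j = tact S (fun i => M i *m M' i) j.
Proof.
rewrite /tact; under eq_bigr do rewrite mulr_suml.
rewrite exchange_big; apply: eq_bigr => l _ /=.
under eq_bigr do rewrite -mulrA -big_split /=; rewrite -mulr_sumr;
  congr (_ * _).
rewrite (big_tuple_ffun (fun i a => M i (tnth l i) a * M' i a (tnth j i))).
by apply: eq_bigr => i _; rewrite mxE.
Qed.

Lemma tact1 (K : comNzRingType) (S : k.-tuple 'I_n -> K) M j :
  (forall i, M i = 1%:M) -> tact S M j = S j.
Proof.
move=> M1; rewrite /tact (bigD1 j) //= big1 => [|i _];
  last by rewrite M1 mxE eqxx.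
rewrite mulr1 big1 ?addr0 // => l ne_lj.
have [i ne_i] : exists i, tnth l i != tnth j i.
  apply/existsP; apply: contraNT ne_lj; rewrite negb_exists => /forallP eq_lj.
  by apply/eqP/eq_from_tnth => i; apply/eqP; have := eq_lj i; rewrite negbK.
by rewrite (bigD1 i) //= M1 mxE (negPf ne_i) mul0r mulr0.
Qed.

Lemma rmorph_tact (K K' : comNzRingType) (f : {rmorphism K -> K'}) S
    (M : 'I_k -> 'M[K]_n) j :
  f (tact S M j) = tact (f \o S) (fun i => map_mx f (M i)) j.
Proof.
rewrite rmorph_sum; apply: eq_bigr => l _; rewrite rmorphM rmorph_prod.
by congr (_ * _); apply: eq_bigr => i _; rewrite mxE.
Qed.

Lemma eq_tact (K : comNzRingType) (S S' : k.-tuple 'I_n -> K)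
    (M M' : 'I_k -> 'M[K]_n) j :
  S =1 S' -> M =1 M' -> tact S M j = tact S' M' j.
Proof.
move=> eqS eqM; apply: eq_bigr => l _; rewrite eqS; congr (_ * _).
by apply: eq_bigr => i _; rewrite eqM.
Qed.

(** [M i] carries [G] to [c i] times the identity, so the pairing becomes, up to the product of the
    [c i], the standard one between [S] and the vectors [z i]. *)
Lemma qF_tact (F : fieldType) (G : 'M[F]_n) (M : 'I_k -> 'M[F]_n) (c : 'I_k -> F)
    S (T : tensor F n k) (z : 'I_k -> 'rV[F]_n) :
    (forall i, M i *m G *m (M i)^T = (c i)%:M) -> coeft T =1 tact S M ->
  qF G T (pure_tensor (fun i => z i *m M i)) =
  (\prod_i c i) * \sum_l S l * \prod_(i < k) z i 0 (tnth l i).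
Proof.
move=> MG defT; rewrite /qF mulr_sumr.
(* [f] gathers what belongs to slot i, so that sums over index tuples split into products of sums
   over single indices. *)
pose f m i a b := M i (tnth m i) a * ((z i *m M i) 0 b * G a b).
transitivity (\sum_j \sum_l \sum_m S m * \prod_i f m i (tnth j i) (tnth l i)).
  apply: eq_bigr => j _; apply: eq_bigr => l _.
  rewrite defT coeft_pure -mulrA /tact mulr_suml; apply: eq_bigr => m _.
  by rewrite -mulrA -!big_split.
transitivity (\sum_m \sum_j \sum_l S m * \prod_i f m i (tnth j i) (tnth l i)).
  by rewrite [RHS]exchange_big; apply: eq_bigr => j _; rewrite exchange_big.
apply: eq_bigr => m _; rewrite mulrCA.
transitivity (S m * \sum_j \prod_i \sum_b f m i (tnth j i) b).
  rewrite mulr_sumr; apply: eq_bigr => j _; rewrite -mulr_sumr.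
  by rewrite (big_tuple_ffun (fun i => f m i (tnth j i))).
rewrite (big_tuple_ffun (fun i a => \sum_b f m i a b)); congr (_ * _).
rewrite -big_split /=; apply: eq_bigr => i _.
have -> : c i * z i 0 (tnth m i) = (M i *m G *m (M i)^T *m (z i)^T) (tnth m i) 0.
  by rewrite MG mul_scalar_mx !mxE.
rewrite -!mulmxA -trmx_mul [RHS]mxE; apply: eq_bigr => a _.
rewrite /f -mulr_sumr [in RHS]mxE; congr (_ * _); apply: eq_bigr => b _.
by rewrite [(_^T) b 0]mxE mulrC.
Qed.

End TensorAction.

Section Axes.
Variables (n k : nat).

Definition axis (i : 'I_k) (a : 'I_n.+1) : k.-tuple 'I_n.+1 :=
  [tuple if j == i then a else 0 | j < k].

Lemma tnth_axis i a j : tnth (axis i a) j = if j == i then a else 0.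
Proof. exact: tnth_mktuple. Qed.

Lemma axis_inj i i' a a' : a != 0 -> axis i a = axis i' a' -> i = i' /\ a = a'.
Proof.
move=> nz_a eq_ax; have := congr1 (fun l => tnth l i) eq_ax.
rewrite !tnth_axis eqxx; case: eqP => [-> //|_ a0].
by rewrite a0 eqxx in nz_a.
Qed.

(** A tuple with a nonzero entry away from [i] meets a zero coordinate of a multiple of e_0, so only
    the tuples on the i-th axis contribute. *)
Lemma sum_axis (F : comNzRingType) (S : k.-tuple 'I_n.+1 -> F) i (mu : 'I_k -> F)
    (z : 'I_k -> 'rV[F]_n.+1) :
    (forall j, j != i -> z j = mu j *: delta_mx 0 0) ->
  \sum_l S l * \prod_(j < k) z j 0 (tnth l j) =
  (\prod_(j < k | j != i) mu j) * \sum_a S (axis i a) * z i 0 a.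
Proof.
move=> defz; rewrite mulr_sumr.
rewrite (bigID (fun l => l == axis i (tnth l i))) /= [X in _ + X]big1 ?addr0;
  last first.
  move=> l /eqP ne_l; have [j ne_ji nz_lj] : exists2 j, j != i & tnth l j != 0.
    apply: contrapT => nj; apply: ne_l; apply: eq_from_tnth => j;
      rewrite tnth_axis.
    by case: eqP => [->//|/eqP ne_j]; apply/eqP; apply: contraT => nz; case: nj;
      exists j.
  by rewrite (bigD1 j) //= defz // !mxE (negPf nz_lj) andbF mulr0 mul0r mulr0.
rewrite (reindex_onto (axis i) (fun l => tnth l i)) /=; last by move=> l /eqP.
apply: eq_big => [a|a _]; first by rewrite !tnth_axis !eqxx.
rewrite [RHS]mulrCA; congr (_ * _); rewrite (bigD1 i) //= tnth_axis eqxx mulrC.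
congr (_ * _); apply: eq_bigr => j ne_ji.
by rewrite defz // tnth_axis (negPf ne_ji) !mxE !eqxx mulr1.
Qed.

End Axes.

Section SingularTuples.
Variables (F : fieldType) (n k : nat) (G : 'M[F]_n.+1).

Definition singular_vectors (T : tensor F n.+1 k) (x : 'I_k -> 'rV[F]_n.+1) :=
  forall i, exists2 v : 'rV[F]_n.+1,
    (forall y, qform G v y =
       qF G T (pure_tensor (fun j => if j == i then y else x j))) &
    ~~ free [:: v; x i].

(** In orthonormal coordinates, this says that e_0 in every slot is a singular tuple. *)
Definition axis_free (K : comNzRingType) (S : k.-tuple 'I_n.+1 -> K) :=
  forall i a, a != 0 -> S (axis i a) = 0.

Lemma qform_similitude (M : 'M[F]_n.+1) c (x y : 'rV[F]_n.+1) :
  M *m G *m M^T = c%:M -> qform G (x *m M) (y *m M) = c * (x *m y^T) 0 0.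
Proof.
move=> MG; rewrite /qform trmx_mul !mulmxA -(mulmxA x M) -(mulmxA x) MG.
by rewrite mul_mx_scalar -scalemxAl mxE.
Qed.

(** Pairing with e_a [M i] in slot i reads off [S (axis i a)] up to the nonzero factor [C i]. The
    vectors e_a [M i] being orthogonal, the contraction [v] is parallel to e_0 [M i] exactly when
    these numbers vanish for a != 0. *)
Lemma singular_vectors_axis_free (M : 'I_k -> 'M[F]_n.+1) (c mu : 'I_k -> F)
    S (T : tensor F n.+1 k) :
    (forall i, M i *m G *m (M i)^T = (c i)%:M) -> (forall i, c i != 0) ->
    (forall i, mu i != 0) -> coeft T =1 tact S M ->
  singular_vectors T (fun i => mu i *: (delta_mx 0 0 *m M i)) <-> axis_free S.
Proof.
move=> MG nz_c nz_mu defT.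
set x := fun i => _; pose C i := \prod_j c j * \prod_(j | j != i) mu j.
have nz_C i : C i != 0.
  by rewrite mulf_neq0 //; apply/prodf_neq0 => j _.
have qFE i z : qF G T (pure_tensor (fun j =>
  if j == i then z *m M i else x j)) =
               C i * \sum_a S (axis i a) * z 0 a.
  have -> : (fun j => if j == i then z *m M i else x j) =
      (fun j => (if j == i then z else mu j *: delta_mx 0 0) *m M j).
    by apply/funext => j; case: eqP => [->//|_]; rewrite -scalemxAl.
  rewrite (qF_tact (fun j =>
    if j == i then z else mu j *: delta_mx 0 0) MG defT).
  rewrite (sum_axis _ (i := i) (mu := mu)) ?eqxx ?mulrA //.
  by move=> j /negPf->.
have MK i : (c i)^-1 *: (G *m (M i)^T) *m M i = 1%:M.
  by apply: mulmx1C; rewrite -scalemxAr mulmxA MG scale_scalar_mx mulVf.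
have nz_x i : x i != 0.
  rewrite scaler_eq0 negb_or nz_mu /=; apply/eqP => eM0.
  have := congr1 (fun A => A *m ((c i)^-1 *: (G *m (M i)^T))) eM0.
  rewrite mul0mx -mulmxA (mulmx1C (MK i)) mulmx1 => /matrixP/(_ 0 0)/eqP.
  by rewrite !mxE !eqxx oner_eq0.
have freeE i v : ~~ free [:: v; x i] = (v \in <[x i]>%VS).
  by rewrite free_cons span_seq1 seq1_free nz_x andbT negbK.
split=> [sing i a nz_a|S0 i].
  have [v qv] := sing i; rewrite freeE => /vlineP[lam defv].
  have := qv (delta_mx 0 a *m M i); rewrite qFE (bigD1 a) //= big1 => [|b ne_b].
    rewrite addr0 mxE !eqxx mulr1 defv /x scalerA scalemxAl.
    rewrite (qform_similitude _ _ (MG i)) -scalemxAl trmx_delta mul_delta_mx_cond.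
    rewrite eq_sym (negPf nz_a) mulr0n scaler0 mxE mulr0 => /esym/eqP.
    by rewrite mulf_eq0 (negPf (nz_C i)) => /eqP.
  by rewrite mxE (negPf ne_b) andbF mulr0.
(* The contraction is determined by its pairing with e_0 [M i], whose square norm is [c i]. *)
exists ((C i * S (axis i 0) / c i) *: (delta_mx 0 0 *m M i)) => [y|];
  last first.
  rewrite freeE; apply/vlineP; exists (C i * S (axis i 0) / c i / mu i).
  by rewrite /x scalerA divfK.
have -> : y = (y *m ((c i)^-1 *: (G *m (M i)^T))) *m M i.
  by rewrite -mulmxA MK mulmx1.
set z := y *m _; rewrite qFE scalemxAl (qform_similitude _ _ (MG i)).
rewrite (bigD1 0) //= [X in _ * (_ + X)]big1 ?addr0 => [|a nz_a]; last first.
  by rewrite S0 ?mul0r.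
by rewrite -scalemxAl mxE -rowE !mxE mulrA [c i * _]mulrC divfK // mulrA.
Qed.

End SingularTuples.

(** * Positions and blocks of a repeated tuple *)

Section Blocks.

(** Repeating the block numbers themselves gives a list [bs]: [b] reads off it the block of a
    position, [pos] finds the first position of a block. As all parts are at least 1, every block
    number occurs. *)
Lemma repeat_blocks_index (k : nat) (omega : seq nat) : is_partition k omega ->
  exists (b : 'I_k -> 'I_(size omega)) (pos : 'I_(size omega) -> 'I_k),
    cancel pos b /\
    forall (F : fieldType) n (p : (size omega).-tuple (proj F n))
        (s : k.-tuple (proj F n)),
      tval s = repeat_blocks omega p <-> forall i, tnth s i = tnth p (b i).
Proof.
move=> [_ omega1 omegak].
pose blocks (A : Type) (om : seq nat) (l : seq A) :=
  flatten [seq nseq wp.1 wp.2 | wp <- zip om l].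
have map_blocks (A A' : Type) (f : A -> A') om l :
    blocks A' om (map f l) = map f (blocks A om l).
  elim: om l => [|w om IH] [|a l] //=.
  by rewrite /blocks /= map_cat map_nseq; congr (_ ++ _); exact: IH.
have size_blocks A om l : size om = size l -> size (blocks A om l) = sumn om.
  elim: om l => [|w om IH] [|a l] //= [/IH eq_s].
  by rewrite /blocks /= size_cat size_nseq -/(blocks A om l) eq_s.
have mem_blocks (A : eqType) om (l : seq A) a : size om = size l ->
    all (leq 1) om -> a \in l -> a \in blocks A om l.
  elim: om l => [|w om IH] [|a' l] //= [/IH{}IH] /andP[w1 om1].
  rewrite inE /blocks /= mem_cat mem_nseq w1 /= => /orP[->//|/(IH om1) ->].
  exact: orbT.
pose bs := blocks _ omega (enum 'I_(size omega)).
have sz_bs : size bs == k by rewrite size_blocks ?size_enum_ord ?omegak.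
have idx j : (index j bs < k)%N.
  rewrite -(eqP sz_bs) index_mem; apply: mem_blocks => //.
    by rewrite size_enum_ord.
  by rewrite mem_enum.
exists (tnth (Tuple sz_bs)), (fun j => Ordinal (idx j)); split=> [j|F n p s].
  rewrite (tnth_nth j) /= nth_index // -index_mem (eqP sz_bs); exact: idx.
have -> : repeat_blocks omega p = map (tnth p) bs.
  by rewrite -map_blocks map_tnth_enum.
split=> [eq_s i|eq_s].
  have -> : s = map_tuple (tnth p) (Tuple sz_bs) by apply: val_inj.
  exact: tnth_map.
suff -> : s = map_tuple (tnth p) (Tuple sz_bs) by [].
by apply: eq_from_tnth => i; rewrite tnth_map eq_s.
Qed.

End Blocks.

(** * First-order expansion of products and reflections *)

Section FirstOrderCoefficients.
Variable K : comNzRingType.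

Lemma coef1M (p q : {poly K}) : (p * q)`_1 = p`_0 * q`_1 + p`_1 * q`_0.
Proof. by rewrite coefM !big_ord_recl big_ord0 addr0. Qed.

Lemma coef0_prod (I : Type) (r : seq I) (A : pred I) (p : I -> {poly K}) :
  (\prod_(i <- r | A i) p i)`_0 = \prod_(i <- r | A i) (p i)`_0.
Proof. by elim/big_rec2: _ => [|i y q _ <-]; rewrite ?coef1 ?coef0M. Qed.

Lemma coef1_prod (I : finType) (p : I -> {poly K}) :
  (\prod_i p i)`_1 = \sum_i (p i)`_1 * \prod_(j | j != i) (p j)`_0.
Proof.
elim: (index_enum I) (index_enum_uniq I) => [_|i r IH /= /andP[ri /IH{}IH]].
  by rewrite !big_nil coef1.
rewrite !big_cons eqxx coef1M addrC IH coef0_prod; congr (_ * _ + _).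
  rewrite big_seq [RHS]big_seq_cond; apply: eq_bigl => j /=.
  by case jr : (j \in r) => //=; apply/esym; apply: contraNneq ri => <-.
rewrite mulr_sumr big_seq [RHS]big_seq; apply: eq_bigr => j jr.
have ne_ij : i != j by apply: contraNneq ri => ->.
by rewrite big_cons ne_ij; exact: mulrCA.
Qed.

(** Near u = e_0 the square norm is constant to first order. The matrix starts at the reflection in
    e_0, and its first row moves by -2 [h] off the diagonal. *)
Lemma coef_refl n (u : 'rV[{poly K}]_n.+1) (h : 'I_n.+1 -> K) :
  u 0 0 = 1 -> (forall a, a != 0 -> u 0 a = h a *: 'X) ->
  (forall a c, (refl u a c)`_0 = if a == c then (if a == 0 then -1 else 1) else 0)
  /\ (forall c, (refl u 0 c)`_1 = if c == 0 then 0 else - 2%:R * h c).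
Proof.
move=> u0 ua.
have ua0 a : (u 0 a)`_0 = (a == 0)%:R.
  by case: (eqVneq a 0) => [->|/ua->]; rewrite ?u0 ?coef1 // coefZ coefX mulr0.
have ua1 a : (u 0 a)`_1 = if a == 0 then 0 else h a.
  by case: (eqVneq a 0) => [->|/ua->]; rewrite ?u0 ?coef1 // coefZ coefX mulr1.
have sqE : sqnorm u = 1 + (\sum_(a | a != 0) h a ^+ 2) *: 'X^2.
  rewrite /sqnorm mxE (bigD1 0) //= mxE u0 mulr1; congr (_ + _).
  rewrite scaler_suml; apply: eq_bigr => a nz_a.
  by rewrite mxE ua // -scalerAl -scalerAr scalerA -!expr2.
have sq0 : (sqnorm u)`_0 = 1 by rewrite sqE coefD coefZ coefXn coef1 mulr0 addr0.
have sq1 : (sqnorm u)`_1 = 0 by rewrite sqE coefD coefZ coefXn coef1 mulr0 addr0.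
have reflE a c : refl u a c = sqnorm u *+ (a == c) - (u 0 a * u 0 c) *+ 2.
  by rewrite !mxE big_ord1 !mxE mulr_natl.
split=> [a c|c]; rewrite reflE coefB !coefMn.
  rewrite coef0M !ua0 sq0; case: (eqVneq a c) => [<-|ne_ac].
    by case: eqVneq => _; rewrite ?mulr1 ?mulr0 ?mul0rn ?subr0 // mulr2n opprD addrA subrr add0r.
  case: (eqVneq a 0) ne_ac => [->|_ _]; last by rewrite mul0r mul0rn subr0.
  by rewrite eq_sym => /negPf->; rewrite mulr0 mul0rn subr0.
rewrite coef1M !ua0 !ua1 sq1 eqxx mul0rn sub0r mul0r addr0 mul1r.
by case: eqP => _; rewrite ?mul0rn ?oppr0 // mulNr mulr_natl.
Qed.

End FirstOrderCoefficients.

(** * Parametrization of the tensors with a singular tuple *)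

Section Parametrization.
Variables (n k t : nat) (b : 'I_k -> 'I_t) (pos : 'I_t -> 'I_k).
Hypothesis bK : cancel pos b.
Local Notation idx := (k.-tuple 'I_n.+1).
Implicit Types (j l : idx).

Definition origin : idx := [tuple 0 | i < k].

Definition off_axis : {set idx} :=
  [set j | [forall i, forall a, (a != 0) ==> (j != axis i a)]].

(* The coordinates in [off_axis] are those of T_0; those on the axes through
   [pos] serve as the coordinates of u_1, ..., u_t other than u 0 0 = 1. *)
Definition free_index : {set idx} :=
  ~: [set axis p.1 p.2 | p in [set p | (p.1 \notin codom pos) && (p.2 != 0)]].

Lemma off_axisP j :
  reflect (forall i a, a != 0 -> j != axis i a) (j \in off_axis).
Proof.
rewrite inE; apply: (iffP forallP) => [jP i a nz_a|jP i].
  by have /forallP/(_ a)/implyP/(_ nz_a) := jP i.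
by apply/forallP => a; apply/implyP; exact: jP.
Qed.

Lemma origin_off_axis : origin \in off_axis.
Proof.
apply/off_axisP => i a nz_a; apply: contra_neq nz_a => eq_o.
have := congr1 (fun l => tnth l i) eq_o.
by rewrite tnth_axis eqxx tnth_mktuple.
Qed.

Lemma axis_off_axisF i a : a != 0 -> axis i a \in off_axis = false.
Proof. by move=> nz_a; apply/negP => /off_axisP/(_ i a nz_a); rewrite eqxx. Qed.

Lemma off_axis_free j : j \in off_axis -> j \in free_index.
Proof.
move=> /off_axisP jP; rewrite inE; apply/imsetP => -[[i a]].
by rewrite inE /= => /andP[_ /jP nj] /eqP; rewrite (negPf (nj i)).
Qed.

Lemma axis_pos_free c a : a != 0 -> axis (pos c) a \in free_index.
Proof.
move=> nz_a; rewrite inE; apply/imsetP => -[[i a']].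
rewrite inE /= => /andP[ni _] /(axis_inj nz_a)[eq_i _].
by case/negP: ni; rewrite -eq_i codom_f.
Qed.

Lemma free_indexP j : j \in free_index ->
  j \in off_axis \/ exists c a, a != 0 /\ j = axis (pos c) a.
Proof.
move=> jfree; have [|nj] := boolP (j \in off_axis); first by left.
right; move: nj; rewrite inE negb_forall => /existsP[i'].
rewrite negb_forall => /existsP[a]; rewrite negb_imply negbK =>
  /andP[nz_a /eqP defj].
move: jfree; rewrite inE => /imsetP nj.
have [/codomP[c defi]|ni] := boolP (i' \in codom pos).
  by exists c, a; rewrite -defi.
by case: nj; exists (i', a) => //; rewrite inE /= ni nz_a.
Qed.

(** The discarded indices are the axis tuples at the k - t positions outside the image of [pos],
    with n nonzero values each; their number is the codimension sought. *)
Lemma card_free_indexC : #|{: idx}| = (#|free_index| + (k - t) * n)%N.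
Proof.
rewrite -(cardC (mem free_index)); congr (_ + _)%N.
rewrite (eq_card (B := mem [set axis p.1 p.2 | p in
   [set p : 'I_k * 'I_n.+1 | (p.1 \notin codom pos) && (p.2 != 0)]]));
     last first.
  by move=> j; rewrite [LHS]inE /= /free_index finset.in_setC negbK.
rewrite card_in_imset => [|[i a] [i' a']]; last first.
  by rewrite !inE /= => /andP[_ nz_a] _ /(axis_inj nz_a)[-> ->].
rewrite (eq_card (B := [predX [predC (codom pos)] & predC1 (0 : 'I_n.+1)]));
  last first.
  by move=> [i a]; rewrite !inE.
rewrite cardX cardC1 card_ord; congr (_ * _)%N.
have := cardC (mem (codom pos)); rewrite card_codom; last exact: can_inj bK.
by rewrite !card_ord => /(congr1 (subn^~ t)); rewrite addKn.
Qed.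

Definition mirror (K : comNzRingType) (Y : idx -> K) (c : 'I_t) : 'rV[K]_n.+1 :=
  \row_a if a == 0 then 1 else Y (axis (pos c) a).

Definition core (K : comNzRingType) (Y : idx -> K) j : K :=
  if j \in off_axis then Y j else 0.

(** The image of T_0 = [core Y] under the reflections, in orthonormal coordinates. The ring is
    general so that one formula serves points, polynomial parameters and curves. *)
Definition psi (K : comNzRingType) (Y : idx -> K) : idx -> K :=
  tact (core Y) (fun i => refl (mirror Y (b i))).

Definition extend (K : comNzRingType) (y : 'I_#|free_index| -> K) : idx -> K :=
  fun j => \sum_(i | enum_val i == j) y i.

Lemma rmorph_psi (K K' : comNzRingType) (f : {rmorphism K -> K'}) Y j :
  f (psi Y j) = psi (f \o Y) j.
Proof.
rewrite rmorph_tact; apply: eq_tact => [l|i].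
  by rewrite /core /=; case: ifP => // _; rewrite rmorph0.
rewrite map_refl; congr refl; apply/rowP => a; rewrite !mxE.
by case: ifP => // _; rewrite rmorph1.
Qed.

Lemma eq_psi (K : comNzRingType) (Y Y' : idx -> K) :
  {in free_index, Y =1 Y'} -> psi Y =1 psi Y'.
Proof.
move=> eqY j; apply: eq_tact => [l|i].
  by rewrite /core; case: ifP => // /off_axis_free/eqY.
congr refl; apply/rowP => a; rewrite !mxE; case: eqP => // /eqP nz_a.
exact/eqY/axis_pos_free.
Qed.

Lemma extend_enum_val (K : comNzRingType) (y : 'I_#|free_index| -> K) i :
  extend y (enum_val i) = y i.
Proof.
rewrite /extend (eq_bigl (pred1 i)) ?big_pred1_eq // => i'.
by rewrite /= (inj_eq enum_val_inj).
Qed.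

Lemma extendK (K : comNzRingType) (Y : idx -> K) :
  {in free_index, extend (fun i => Y (enum_val i)) =1 Y}.
Proof. by move=> j jI; rewrite -(enum_rankK_in jI jI) extend_enum_val. Qed.

Lemma rmorph_extend (K K' : comNzRingType) (f : {rmorphism K -> K'}) y :
  f \o extend y =1 extend (f \o y).
Proof. by move=> j; rewrite /= rmorph_sum. Qed.

Section Expansion.
Variable K : idomainType.
Hypothesis nz2 : 2%:R != 0 :> K.

(** These are the diagonal entries of the differential at the base point: products of signs of the
    reflection in e_0 for the coordinates of T_0, and the derivative of one reflected factor for
    those of a mirror. *)
Definition psi_coef1 j : K :=
  if j \in off_axis then \prod_(i < k) (if tnth j i == 0 then -1 else 1)
  else - 2%:R * (-1) ^+ k.-1.

Lemma psi_coef1_neq0 j : psi_coef1 j != 0.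
Proof.
rewrite /psi_coef1; case: ifP => _.
  apply/prodf_neq0 => i _; case: ifP; by rewrite ?oppr_eq0 oner_eq0.
by rewrite mulf_neq0 ?oppr_eq0 ?signr_eq0.
Qed.

(* The line with direction [z] through the parameters u_c = e_0,
   T_0 = e_0 (x) ... (x) e_0. *)
Definition base_line (z : idx -> K) j : {poly K} :=
  (j == origin)%:R + z j *: 'X.

(** The first-order term has two sources: varying one reflection on e_0 in every slot, which reaches
    only axis tuples, and varying T_0 under the reflection in e_0, which is diagonal. On a free axis
    tuple only the slot [pos c] counts, and it carries mirror [c]. *)
Lemma psi_base_line (z : idx -> K) j : j \in free_index ->
  (psi (base_line z) j)`_0 = \prod_(i < k) (if 0 == tnth j i then -1 else 0) /\
  (psi (base_line z) j)`_1 = psi_coef1 j * z j.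
Proof.
move=> jfree; set Y := base_line z; pose R i := refl (mirror Y (b i)).
pose h i a := z (axis (pos (b i)) a).
have [R0 R1] : (forall i a c, (R i a c)`_0 =
      if a == c then (if a == 0 then -1 else 1) else 0) /\
    (forall i c, (R i 0 c)`_1 = if c == 0 then 0 else - 2%:R * h i c).
  have Ri i := @coef_refl K n (mirror Y (b i)) (h i).
  split=> [i|i]; have [||? ?] // := Ri i; rewrite ?mxE // => a nz_a.
  - rewrite mxE (negPf nz_a) /Y /base_line (_ : _ == origin = false) ?add0r //.
    by apply: contraTF origin_off_axis => /eqP<-; rewrite axis_off_axisF.
  - rewrite mxE (negPf nz_a) /Y /base_line (_ : _ == origin = false) ?add0r //.
    by apply: contraTF origin_off_axis => /eqP<-; rewrite axis_off_axisF.
have core0 l : (core Y l)`_0 = (l == origin)%:R.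
  rewrite /core /Y /base_line; case: ifP => [_|l_ax].
    by rewrite coefD coefZ coefX mulr0 addr0 -polyC_natr coefC.
  by rewrite coef0; case: eqP l_ax => // ->; rewrite origin_off_axis.
have core1 l : (core Y l)`_1 = if l \in off_axis then z l else 0.
  rewrite /core /Y /base_line; case: ifP => [_|_]; last by rewrite coef0.
  by rewrite coefD coefZ coefX mulr1 -polyC_natr coefC add0r.
split.
  rewrite /psi /tact coef_sum (bigD1 origin) //= [X in _ + X]big1 =>
    [|l /negPf ne_l].
    rewrite addr0 coef0M core0 eqxx mul1r coef0_prod; apply: eq_bigr => i _.
    by rewrite tnth_mktuple R0.
  by rewrite coef0M core0 ne_l mul0r.
transitivity ((\prod_(i < k) R i 0 (tnth j i))`_1 +
    (core Y j)`_1 * \prod_(i < k) (if tnth j i == 0 then -1 else 1)).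
  rewrite /psi /tact coef_sum.
  under eq_bigr do rewrite coef1M core0.
  rewrite big_split /= (bigD1 origin) //= [X in _ + X + _]big1 => [|l /negPf->];
    last by rewrite mul0r.
  rewrite eqxx mul1r addr0; congr (_ + _).
    by rewrite (eq_bigr (fun i => R i 0 (tnth j i))) // => i _;
      rewrite tnth_mktuple.
  rewrite (bigD1 j) //= [X in _ + X]big1 => [|l ne_lj].
    rewrite addr0 coef0_prod; congr (_ * _); apply: eq_bigr => i _.
    by rewrite R0 eqxx.
  have [i ne_i] : exists i, tnth l i != tnth j i.
    apply/existsP; apply: contraNT ne_lj; rewrite negb_exists => /forallP eq_lj.
    by apply/eqP/eq_from_tnth => i; apply/eqP; have := eq_lj i; rewrite negbK.
  by rewrite coef0_prod (bigD1 i) //= R0 (negPf ne_i) mul0r mulr0.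
rewrite coef1_prod core1 /psi_coef1.
have [joff|[c [a [nz_a defj]]]] := free_indexP jfree.
  rewrite joff [X in X + _]big1 ?add0r 1?mulrC // => i _.
  rewrite R1; case: eqP => [_|/eqP nz_ji]; first by rewrite mul0r.
  (* Being off the axes, a tuple with a nonzero entry has a second one, at which the reflected e_0
     has no constant term. *)
  have [i' ne_i' nz_ji'] : exists2 i', i' != i & tnth j i' != 0.
    apply: contrapT => nex; have /off_axisP/(_ i _ nz_ji)/eqP[] := joff.
    apply: eq_from_tnth => i'; rewrite tnth_axis; case: eqP =>
      [->//|/eqP ne_i'].
    by apply/eqP; apply: contraT => nz; case: nex; exists i'.
  by rewrite (bigD1 i') //= R0 eq_sym (negPf nz_ji') mul0r mulr0.
rewrite defj axis_off_axisF // mul0r addr0 (bigD1 (pos c)) //=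
  [X in _ + X]big1 => [|i ne_i].
  rewrite addr0 R1 tnth_axis eqxx (negPf nz_a) /h bK mulrAC; congr (_ * _ * _).
  rewrite (eq_bigr (fun=> -1)) ?prodr_const => [|i ne_i].
    by congr (_ ^+ _); rewrite (cardC1 (pos c)) card_ord.
  by rewrite R0 tnth_axis (negPf ne_i) eqxx.
by rewrite R1 tnth_axis (negPf ne_i) eqxx mul0r.
Qed.

End Expansion.

End Parametrization.

(** * The cone of parametrized tensors and its closure *)

Section Kappa.
Local Open Scope classical_set_scope.
Variables (F : numClosedFieldType) (n k : nat) (G B : 'M[F]_n.+1).
Hypothesis BG : B *m G *m B^T = 1%:M.
Variables (omega : seq nat) (b : 'I_k -> 'I_(size omega)).
Variable pos : 'I_(size omega) -> 'I_k.
Hypothesis bK : cancel pos b.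
Hypothesis blocks : forall (p : (size omega).-tuple (proj F n.+1))
    (s : k.-tuple (proj F n.+1)),
  tval s = repeat_blocks omega p <-> forall i, tnth s i = tnth p (b i).

Local Notation idx := (k.-tuple 'I_n.+1).
Local Notation psi := (psi b pos).
Local Notation r := #|free_index n pos|.
Local Notation N := (tensor_dim n.+1 k).
Local Notation e0 := (delta_mx 0 0 : 'rV[F]_n.+1).

(** Isotropic mirrors are allowed, which makes the cone the image of a whole affine space. The
    matrix [B] leads from orthonormal back to standard coordinates. *)
Definition kappa_cone : set (tensor F n.+1 k) :=
  [set x | exists Y : idx -> F, coeft x =1 tact (psi Y) (fun=> B)].

Definition singular_set : set (proj F N) :=
  [set L | exists2 T : tensor F n.+1 k,
     val L = <[T]>%VS & has_nonisotropic_singular_tuple G omega T].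

Definition param_tensor (Y : idx -> F) : tensor F n.+1 k :=
  \row_a tact (psi Y) (fun=> B) (enum_val a).

Definition param_poly (a : 'I_N) : {mpoly F[r]} :=
  tact (psi (extend (fun i : 'I_r => 'X_i : {mpoly F[r]})))
       (fun=> map_mx (@mpolyC r F) B) (enum_val a).

(** The inverse [G *m B^T] of [B] undoes the change of basis, so these polynomials read off the
    coordinates of [psi Y] at the free indices. *)
Definition coord_poly (i : 'I_r) : {mpoly F[N]} :=
  tact (fun l : idx => 'X_(enum_rank l) : {mpoly F[N]})
       (fun=> map_mx (@mpolyC N F) (G *m B^T)) (enum_val i).

Lemma BK : (G *m B^T) *m B = 1%:M.
Proof. by apply: mulmx1C; rewrite mulmxA. Qed.

Lemma coeft_param Y : coeft (param_tensor Y) =1 tact (psi Y) (fun=> B).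
Proof. by move=> j; rewrite /coeft mxE enum_rankK. Qed.

Lemma coeft_inj (T T' : tensor F n.+1 k) : coeft T =1 coeft T' -> T = T'.
Proof. by move=> eqT; apply/rowP => a; have := eqT (enum_val a);
  rewrite /coeft enum_valK. Qed.

Lemma map_mx_meval m (v : 'I_m -> F) (A : 'M[F]_n.+1) :
  map_mx (meval v) (map_mx (@mpolyC m F) A) = A.
Proof. by apply/matrixP => i j; rewrite !mxE mevalC. Qed.

Lemma param_polyE (y : 'I_r -> F) :
  mpoly_map param_poly y = param_tensor (extend y).
Proof.
apply/rowP => a; rewrite !mxE /param_poly rmorph_tact.
apply: eq_tact => [l|i]; last exact: map_mx_meval.
rewrite /= rmorph_psi; apply: eq_psi => j _; rewrite rmorph_extend.
by apply: eq_bigr => i _; rewrite /= mevalXU.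
Qed.

Lemma param_tensor_extend Y :
  param_tensor Y = param_tensor (extend (fun i : 'I_r => Y (enum_val i))).
Proof.
apply: coeft_inj => j; rewrite !coeft_param; apply: eq_tact => // l.
by apply: eq_psi => j' j'I; rewrite extendK.
Qed.

Lemma kappa_coneP x : kappa_cone x <-> exists Y, x = param_tensor Y.
Proof.
split=> [[Y defx]|[Y ->]]; last by exists Y; exact: coeft_param.
by exists Y; apply: coeft_inj => j; rewrite defx coeft_param.
Qed.

Lemma polynomial_image_kappa_cone : polynomial_image kappa_cone param_poly.
Proof.
apply/seteqP; split=> [x /kappa_coneP[Y ->]|_ [y _ <-]]; last first.
  by apply/kappa_coneP; exists (extend y); rewrite param_polyE.
by exists (fun i => Y (enum_val i));
  rewrite // param_polyE -param_tensor_extend.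
Qed.

Lemma coord_polyE Y i : (coord_poly i).@[param_tensor Y 0] = psi Y (enum_val i).
Proof.
rewrite /coord_poly rmorph_tact.
transitivity (tact (tact (psi Y) (fun=> B)) (fun=> G *m B^T) (enum_val i)).
  apply: eq_tact => [l|_]; last exact: map_mx_meval.
  by rewrite /= mevalXU -[LHS]/(coeft (param_tensor Y) l) coeft_param.
by rewrite tact_comp tact1 // => _; rewrite mulmxA.
Qed.

Lemma psi_horner (z : idx -> F) (s : F) j :
  (psi (base_line z) j).[s] = psi (fun l => (base_line z l).[s]) j.
Proof. exact: (rmorph_psi b pos (horner_eval s)). Qed.

(** With T_0 = e_0 in every slot and all mirrors e_0, this shows that the cone is nonzero and that
    mirrors are generically nonisotropic. *)
Lemma base_point : exists Y : idx -> F,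
  param_tensor Y != 0 /\ forall c, sqnorm (mirror pos Y c) != 0.
Proof.
pose Y (l : idx) : F := (base_line (fun=> 0) l).[0].
have YE l : Y l = (l == origin n k)%:R.
  by rewrite /Y /base_line scale0r addr0 -polyC_natr hornerC.
exists Y; split=> [|c].
  apply/eqP => Y0; have : psi Y (origin n k) = 0.
    have BBi : (fun _ : 'I_k => B *m (G *m B^T)) =1 fun=> 1%:M by move=> _;
      rewrite mulmxA.
    rewrite -(tact1 (psi Y) (M := fun=> B *m (G *m B^T)) (origin n k) BBi).
    rewrite -(tact_comp (psi Y) (fun=> B) (fun=> G *m B^T)).
    apply: big1 => l _; rewrite -coeft_param Y0 /coeft mxE mul0r //.
  have [|psi0 _] := psi_base_line bK (fun=> 0 : F) (j := origin n k).
    exact/off_axis_free/origin_off_axis.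
  rewrite -psi_horner horner_coef0 psi0 => /eqP; rewrite prodf_seq_eq0.
  by move=> /hasP[i _]; rewrite /= tnth_mktuple eqxx oppr_eq0 oner_eq0.
rewrite /sqnorm mxE (bigD1 0) //= big1 => [|a nz_a].
  by rewrite !mxE eqxx mulr1 addr0 oner_eq0.
rewrite !mxE (negPf nz_a) YE (_ : _ == origin n k = false) ?mul0r //.
by apply: contraTF (origin_off_axis n k) => /eqP<-; rewrite axis_off_axisF.
Qed.

Lemma is_cone_kappa_cone : is_cone kappa_cone.
Proof.
split=> [a x [Y defx]|]; last first.
  by have [Y [nz_Y _]] := base_point; exists (param_tensor Y) => //;
    apply/kappa_coneP; exists Y.
(* Only the coordinates of T_0 are scaled: the mirrors stay, and the parametrization is linear in
   T_0. *)
exists (fun j => if j \in off_axis n k then a * Y j else Y j) => j.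
rewrite /coeft mxE -/(coeft x j) defx mulr_sumr; apply: eq_bigr => l _.
rewrite mulrA; congr (_ * _); rewrite mulr_sumr; apply: eq_bigr => m _.
rewrite mulrA /core; congr (_ * _); first by case: ifP => // _; rewrite mulr0.
apply: eq_bigr => i _; congr (refl _ _ _); apply/rowP => a'; rewrite !mxE.
by case: eqP => // /eqP nz_a'; rewrite axis_off_axisF.
Qed.

Lemma algindep_kappa_cone : algindep_on (proj_closure kappa_cone) coord_poly.
Proof.
move=> P /(vanishes_proj_closure _ is_cone_kappa_cone) P0.
apply: (@mpoly_eq0_first_order F r P _ (fun i => psi_coef1 F (enum_val i))).
  by move=> i; apply: psi_coef1_neq0; rewrite pnatr_eq0.
move=> z; exists (fun i => psi (base_line (extend z)) (enum_val i)).
have lineP i := psi_base_line bK (extend z) (enum_valP i).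
split=> [i|i|]; [exact: (lineP i).1| |].
  by rewrite (lineP i).2 extend_enum_val.
apply: poly_fun0 => s; pose Y l := (base_line (extend z) l).[s].
have := P0 (param_tensor Y); rewrite meval_mmap => <-; last first.
  by apply/kappa_coneP; exists Y.
rewrite /mmap horner_sum mevalE; apply: eq_bigr => m _.
rewrite hornerM hornerC /mmap1 horner_prod; congr (_ * _); apply: eq_bigr =>
  i _.
by rewrite horner_exp coord_polyE psi_horner.
Qed.

Lemma refl_similitude (u : 'rV[F]_n.+1) :
  (refl u *m B) *m G *m (refl u *m B)^T = (sqnorm u ^+ 2)%:M.
Proof.
by rewrite trmx_mul !mulmxA -(mulmxA _ B) -(mulmxA _ (B *m G)) BG mulmx1 refl_sqr.
Qed.

Lemma qform_refl (u : 'rV[F]_n.+1) :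
  qform G (e0 *m (refl u *m B)) (e0 *m (refl u *m B)) = sqnorm u ^+ 2.
Proof.
by rewrite (qform_similitude _ _ (refl_similitude u)) trmx_delta mul_delta_mx mxE eqxx mulr1.
Qed.

Lemma nonisotropicP (L : proj F n.+1) (x : 'rV[F]_n.+1) : val L = <[x]>%VS ->
  ~ isotropic_quadric G L <-> qform G x x != 0.
Proof.
move=> defL; split=> [nisoL|nz_q isoL].
  apply/eqP => q0; apply: nisoL => y; rewrite defL => /vlineP[a ->].
  by rewrite /qform linearZ /= -scalemxAr -!scalemxAl scalerA mxE -/(qform G x x) q0 mulr0.
by case/eqP: nz_q; apply: isoL; rewrite defL memv_line.
Qed.

Lemma singular_set_param (L : proj F N) (Y : idx -> F) :
    (forall c, sqnorm (mirror pos Y c) != 0) -> val L = <[param_tensor Y]>%VS ->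
  singular_set L.
Proof.
move=> nz_Y defL; exists (param_tensor Y) => //.
pose w c := e0 *m (refl (mirror pos Y c) *m B).
have qw c : qform G (w c) (w c) != 0 by rewrite qform_refl expf_neq0.
have line c : exists L' : proj F n.+1, val L' = <[w c]>%VS.
  apply: proj_line; apply: contra_neq (qw c) => ->.
  by rewrite /qform !mul0mx mxE.
have [p defp] := choice line.
exists (mktuple p); split=> [c|].
  by apply/nonisotropicP; rewrite ?tnth_mktuple ?defp.
exists (mktuple (fun i => p (b i))).
  by apply/blocks => i; rewrite !tnth_mktuple.
exists (fun i => 1 *: w (b i)) => [i|];
  first by rewrite tnth_mktuple defp scale1r.
apply/(singular_vectors_axis_free (G := G) (c := fun i =>
  sqnorm (mirror pos Y (b i)) ^+ 2)
         (mu := fun=> 1) (S := core Y)) => //.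
- by move=> i; exact: refl_similitude.
- by move=> i; rewrite expf_neq0.
- by move=> i; exact: oner_neq0.
- by move=> j; rewrite coeft_param tact_comp.
by move=> i a nz_a; rewrite /core axis_off_axisF.
Qed.

Lemma axis_free_core (S : idx -> F) (u : 'I_(size omega) -> 'rV[F]_n.+1) :
  axis_free S -> (forall c, u c 0 0 = 1) ->
  exists Y, core Y =1 S /\ forall c, mirror pos Y c = u c.
Proof.
(* The axis coordinates of [Y] at the positions [pos c] store the vectors [u c]; injectivity of
   [pos] leaves at most one term in the sum. *)
move=> S0 u1; pose Y j := if j \in off_axis n k then S j else
  \sum_(p | (p.2 != 0) && (axis (pos p.1) p.2 == j)) u p.1 0 p.2.
exists Y; split=> [j|c].
  rewrite /core /Y; case: off_axisP => // nj.
  apply/esym/eqP; apply: contraT => nz_Sj; case: nj => i a nz_a.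
  by apply: contra_neq nz_Sj => ->; exact: S0.
apply/rowP => a; rewrite mxE; case: eqP => [->//|/eqP nz_a].
rewrite /Y axis_off_axisF // (big_pred1 (c, a)) // => -[c' a'] /=.
rewrite xpair_eqE; apply/andP/andP => [[nz_a' /eqP/(axis_inj nz_a')[]]|].
  by move=> /(can_inj bK)-> ->.
by move=> [/eqP-> /eqP->].
Qed.

(** Each block has a reflection taking <e_0> to its line. Transporting [T] back by these similitudes
    gives an axis-free tensor, so [T] is parametrized. *)
Lemma singular_set_cone (L : proj F N) : singular_set L -> proj_closure kappa_cone L.
Proof.
move=> [T defL [p [niso [s /blocks defs [x defx sing]]]]].
have uP c : exists u : 'rV[F]_n.+1, [/\ u 0 0 = 1, sqnorm u != 0 &
    val (tnth p c) = <[e0 *m (refl u *m B)]>%VS].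
  have [w nz_w defw] := lineP (tnth p c).
  have := niso c; rewrite (nonisotropicP defw).
  have defz : w = (w *m (G *m B^T)) *m B by rewrite -mulmxA BK mulmx1.
  rewrite {1 2}defz (qform_similitude (c := 1)) // mul1r => nz_z.
  have [u [u1 nz_u [a nz_a za]]] := nonisotropic_refl nz_z.
  exists u; split=> //; rewrite defw defz za -scalemxAl -mulmxA.
  apply/eqP; rewrite eqEsubv -!memvE; apply/andP; split; apply/vlineP.
    by exists a.
  by exists a^-1; rewrite scalerA mulVf // scale1r.
have [u {}uP] := choice uP.
pose M i := refl (u (b i)) *m B; pose c i := sqnorm (u (b i)) ^+ 2.
have nz_c i : c i != 0 by have [_ nz _] := uP (b i); rewrite expf_neq0.
have xP i : exists m, m != 0 /\ x i = m *: (e0 *m M i).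
  have [_ _] := uP (b i); rewrite -defs defx => eq_line.
  have /vlineP[m xm] : x i \in <[e0 *m M i]>%VS by rewrite -eq_line memv_line.
  exists m; split=> //; apply/eqP => m0; have /eqP := valP (tnth s i).
  by rewrite defx xm m0 scale0r dim_vline eqxx.
have [m {}xP] := choice xP.
have MK i : (c i)^-1 *: (G *m (M i)^T) *m M i = 1%:M.
  by apply: mulmx1C; rewrite -scalemxAr mulmxA refl_similitude scale_scalar_mx mulVf.
pose S := tact (coeft T) (fun i => (c i)^-1 *: (G *m (M i)^T)).
have defT : coeft T =1 tact S M by move=> j; rewrite tact_comp tact1.
have defxm : x = fun i => m i *: (e0 *m M i) by apply/funext => i;
  exact: (xP i).2.
have S0 : axis_free S.
  apply/(singular_vectors_axis_free (G := G) (c := c) (mu := m) (S := S) (T := T) (M := M)) => //.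
  - by move=> i; exact: refl_similitude.
  - by move=> i; exact: (xP i).1.
  - by rewrite -defxm.
have [|Y [coreY mirrorY]] := axis_free_core S0 (u := u).
  by move=> c'; have [] := uP c'.
apply: proj_closure_line defL; exists Y => j; rewrite defT [RHS]tact_comp.
by apply: eq_tact => [l|i]; rewrite ?coreY ?mirrorY.
Qed.

(** Density: multiplied by the product [O] of the square norms of the mirrors, the pullback of [f]
    vanishes at every parameter, and [O] is a nonzero polynomial. Thus isotropic mirrors do not
    enlarge the closure. *)
Lemma vanishes_kappa_cone d (f : {mpoly F[N]}) : f \is d.-homog ->
  vanishes singular_set f -> vanishes_on kappa_cone f.
Proof.
(* The zero tensor is no projective point; [f] vanishes there because 0 lies on any line of
   [singular_set]. *)
move=> hf f0; have f00 : f.@[(0 : 'rV_N) 0] = 0.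
  have [Y [/proj_line[L defL] nz_Y]] := base_point.
  exact: (f0 L (singular_set_param nz_Y defL)) (mem0v _).
pose Yp := extend (fun i : 'I_r => 'X_i : {mpoly F[r]}).
pose O : {mpoly F[r]} := \prod_c sqnorm (mirror pos Yp c).
have OE y : O.@[y] = \prod_c sqnorm (mirror pos (extend y) c).
  rewrite rmorph_prod; apply: eq_bigr => c _ /=.
  rewrite /sqnorm !mxE rmorph_sum; apply: eq_bigr => a _.
  have mE a' : (mirror pos Yp c 0 a').@[y] = mirror pos (extend y) c 0 a'.
    rewrite !mxE; case: ifP => _; first exact: meval1.
    by rewrite /Yp /extend rmorph_sum; apply: eq_bigr => i _;
      rewrite /= mevalXU.
  by rewrite rmorphM [(_^T) a 0]mxE [in RHS](mxE _ _ a 0) /= !mE.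
have nz_O : O != 0.
  have [Y [_ nz_Y]] := base_point; apply/eqP => O0.
  have := OE (fun i => Y (enum_val i)); rewrite O0 meval0 => /esym/eqP.
  rewrite prodf_seq_eq0 => /hasP[c _] /=; apply/negP.
  rewrite (_ : mirror _ _ _ = mirror pos Y c) //; apply/rowP => a; rewrite !mxE.
  by case: eqP => // /eqP nz_a; rewrite extendK // axis_pos_free.
apply/(vanishes_on_image _ polynomial_image_kappa_cone).
have : mmap (@mpolyC r F) param_poly f * O = 0.
  apply: mpoly_fun0 => y; rewrite mevalM OE meval_mmap.
  have [nz_y|] := boolP [forall c, sqnorm (mirror pos (extend y) c) != 0];
    last first.
    rewrite negb_forall => /existsP[c]; rewrite negbK => /eqP c0.
    by rewrite (bigD1 c) //= c0 mul0r mulr0.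
  suff -> : f.@[fun i => (param_poly i).@[y]] = 0 by rewrite mul0r.
  transitivity f.@[param_tensor (extend y) 0].
    by apply: meval_eq => a; rewrite -param_polyE mxE.
  have [->//|nz_x] := eqVneq (param_tensor (extend y)) 0.
  have [L defL] := proj_line nz_x.
  apply: (f0 L); last by rewrite defL memv_line.
  by apply: singular_set_param defL; apply/forallP.
by move/eqP; rewrite mulf_eq0 (negPf nz_O) orbF => /eqP.
Qed.

Lemma kappa_norE : kappa_nor G k omega = proj_closure kappa_cone.
Proof.
apply/seteqP; split=> L.
  apply; first exact: zariski_closed_proj_closure.
  by move=> L'; exact: singular_set_cone.
move=> XL Z [S homS ->] sZ f Sf; have [d hf] := homS f Sf.
by apply: (XL d) => //; apply: (vanishes_kappa_cone hf) => L' /sZ; exact.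
Qed.

Lemma kappa_nor_codim :
  irreducible (kappa_nor G k omega) /\
  has_codim (kappa_nor G k omega) ((k - size omega) * n).
Proof.
rewrite kappa_norE; split.
  exact: irreducible_proj_closure is_cone_kappa_cone polynomial_image_kappa_cone.
have := has_codim_proj_closure is_cone_kappa_cone polynomial_image_kappa_cone
  algindep_kappa_cone.
suff -> : (N - r = (k - size omega) * n)%N by [].
by rewrite /tensor_dim (card_free_indexC n bK) addKn.
Qed.

End Kappa.

Lemma has_codim_inj (F : fieldType) N (Z : set (proj F N)) c c' :
  has_codim Z c -> has_codim Z c' -> c = c'.
Proof.
move=> [[Y chY] maxc] [[Y' chY'] maxc']; apply/eqP.
by rewrite eqn_leq (maxc' _ _ chY) (maxc _ _ chY').
Qed.

Theorem theorem44 (R : realType) (n k : nat) (G : 'M[R]_n) (omega : seq nat) :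
  (0 < n)%N -> (0 < k)%N ->
  positive_definite G ->
  is_partition k omega ->
  [/\ irreducible (kappa_nor (complexify G) k omega),
      has_codim (kappa_nor (complexify G) k omega)
        ((k - size omega) * (n - 1))%N &
      forall omega' : seq nat, is_partition k omega' ->
        size omega' = size omega ->
        forall c : nat,
          has_codim (kappa_nor (complexify G) k omega) c <->
          has_codim (kappa_nor (complexify G) k omega') c].
Proof.
case: n G => // n G _ _ posG partk.
have [B0 B0G] := positive_definite_orthonormal posG.
pose B := map_mx (real_complex R) B0.
have BG : B *m complexify G *m B^T = 1%:M.
  by rewrite /B /complexify map_trmx -!map_mxM B0G map_mx1.
have codim om : is_partition k om ->
    irreducible (kappa_nor (complexify G) k om) /\
    has_codim (kappa_nor (complexify G) k om) ((k - size om) * n).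
  move=> /repeat_blocks_index[b [pos [bK blocks]]].
  exact: (kappa_nor_codim BG bK (blocks _ _)).
have [irr cod] := codim _ partk.
split=> //; first by rewrite subn1.
move=> om /codim[_ cod'] sz c; rewrite sz in cod'.
by split=> [/(has_codim_inj cod)|/(has_codim_inj cod')] <-.
Qed.
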